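(* Let $\theta_X$ be a formigram over a nonempty finite set $X$ and let $\varepsilon\ge0$. Then the following correspondence is a bijection (of multisets) between $\mathrm{barc}_{\mathbf{ZZ}}(\theta_X)$, with the intervals of the second kind below removed, and $\mathrm{barc}_{\mathbf{ZZ}}(S_\varepsilon\theta_X)$: 1. $(b,d)\leftrightarrow(b+\varepsilon,d-\varepsilon)$ for $-\infty\le b\le b+\varepsilon<d-\varepsilon\le+\infty$; 2. $(b,d)\leftrightarrow$ nothing, for $b<d\le b+2\varepsilon$; 3. $[b,d)\leftrightarrow[b-\varepsilon,d-\varepsilon)$; 4. $(b,d]\leftrightarrow(b+\varepsilon,d+\varepsilon]$; 5. $[b,d]\leftrightarrow[b-\varepsilon,d+\varepsilon]$. Here $\pm\infty+r=\pm\infty$ for $r\in\mathbb{R}$.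
   Context: Subpartitions. A subpartition of $X$ is a partition $P$ of a (possibly empty) subset of $X$; its elements are blocks and $\bigcup P$ is its underlying set. $\mathrm{SubPart}(X)$ is the lattice of all subpartitions of $X$, ordered by $P\le Q$ iff every block of $P$ is contained in some block of $Q$; $\vee$ is the finest common coarsening. Formigrams. A formigram over $X$ is a map $\theta_X:\mathbb{R}\to\mathrm{SubPart}(X)$ such that (a) there is a locally finite set $C\subset\mathbb{R}$ such that $\theta_X$ is constant on each connected component of $\mathbb{R}\setminus C$ and for every $c\in C$ there is $r_c>0$ with $\theta_X(c-\varepsilon)\le\theta_X(c)\ge\theta_X(c+\varepsilon)$ for all $\varepsilon\in[0,r_c)$; (b) for each $x\in X$ there is a (nonempty, possibly unbounded) closed interval $I_x\subset\mathbb{R}$ with $x\in\bigcup\theta_X(t)$ iff $t\in I_x$. $\mathbf{Int}$ is the poset of nonempty bounded closed real intervals ordered by inclusion; $I^\varepsilon=[b-\varepsilon,d+\varepsilon]$ for $I=[b,d]$. A formigram is also regarded as the order-preserving map (functor) $\mathbf{Int}\to\mathrm{SubPart}(X)$, $I\mapsto\bigvee_I\theta_X:=\bigvee\{\theta_X(t):t\in I\}$. The $\varepsilon$-smoothing $S_\varepsilon\theta_X$ is the formigram given by $I\mapsto\bigvee_{I^\varepsilon}\theta_X$, i.e. $(S_\varepsilon\theta_X)(t)=\bigvee_{[t-\varepsilon,t+\varepsilon]}\theta_X$. Zigzag barcode. Fix a field $\mathbb{F}$. For a formigram $\theta$, let $F_{\theta}:\mathbf{Int}\to\mathbf{vec}$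 (finite-dimensional $\mathbb{F}$-vector spaces) send $I$ to the vector space with basis the set of blocks $\bigvee_I\theta$, and $I\subset J$ to the linear extension of the map sending a block to the unique block of $\bigvee_J\theta$ containing it. An interval of a poset is a nonempty, convex subset that is connected (any two elements are joined by a finite sequence of consecutively comparable elements of it); the interval module of $\mathcal{J}$ is $\mathbb{F}$ on $\mathcal{J}$ with identity maps and $0$ elsewhere. It is known that $F_{\theta}$ is isomorphic to a direct sum of interval modules over a unique multiset $\mathrm{barc}(F_{\theta})$ of intervals of $\mathbf{Int}$. $\mathrm{barc}_{\mathbf{ZZ}}(\theta)$ is the multiset of the (nonempty) real intervals $\{t\in\mathbb{R}:[t,t]\in\mathcal{J}\}$, $\mathcal{J}\in\mathrm{barc}(F_{\theta})$; its members are real intervals, with infinite ends considered open. *)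

(* Defs.v *)
From HB Require Import structures.
From mathcomp Require Import all_boot all_order all_algebra.
From mathcomp Require Import all_classical all_reals all_analysis.
From mathcomp Require Import lra.

Set Implicit Arguments.
Unset Strict Implicit.
Unset Printing Implicit Defensive.

Import Order.TTheory GRing.Theory Num.Theory.
Import numFieldTopology.Exports numFieldNormedType.Exports.

Local Open Scope classical_set_scope.
Local Open Scope ring_scope.

(** * Subpartitions of a finite set *)

Record subpart (X : finType) := Subpart {
  blocks :> {set {set X}};
  subpartP : finset.partition blocks (finset.cover blocks) }.

HB.instance Definition _ (X : finType) := [isSub for @blocks X].
HB.instance Definition _ (X : finType) := [Finite of subpart X by <:].

Section SubpartOrder.
Variable X : finType.
Implicit Types P Q S : subpart X.

Definition subpart_le P Q : bool :=
  [forall A in blocks P, exists B in blocks Q, A \subset B].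

Lemma subpart_leP P Q :
  reflect (forall A, A \in blocks P ->
             exists2 B, B \in blocks Q & A \subset B) (subpart_le P Q).
Proof.
apply: (iffP forall_inP) => H A /H; first by case/exists_inP=> B; exists B.
by case=> B BQ AB; apply/exists_inP; exists B.
Qed.

Lemma subpart_block_eq P A B x : A \in blocks P -> B \in blocks P ->
  x \in A -> x \in B -> A = B.
Proof.
case: P => bl /= /and3P[_ /finset.trivIsetP tI _] Abl Bbl xA xB.
apply/eqP; apply: contraT => /(tI _ _ Abl Bbl) /disjointFr /(_ xA).
by rewrite xB.
Qed.

Lemma subpart_block_ex P A : A \in blocks P -> exists x, x \in A.
Proof.
move=> Abl; apply/set0Pn; apply: contraTneq Abl => ->.
by case/and3P: (subpartP P).
Qed.

Lemma subpart_le_refl : reflexive subpart_le.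
Proof. by move=> P; apply/subpart_leP => A AP; exists A. Qed.

Lemma subpart_le_trans : transitive subpart_le.
Proof.
move=> Q P S /subpart_leP PQ /subpart_leP QS; apply/subpart_leP => A.
by case/PQ=> B /QS[C CS BC] AB; exists C => //; apply: fintype.subset_trans BC.
Qed.

Lemma subpart_le_anti : antisymmetric subpart_le.
Proof.
have sub P Q : subpart_le P Q -> subpart_le Q P -> blocks P \subset blocks Q.
  move=> /subpart_leP PQ /subpart_leP QP; apply/fintype.subsetP => A AP.
  have [B BQ AB] := PQ _ AP; have [A' A'P BA'] := QP _ BQ.
  have [x xA] := subpart_block_ex AP.
  have AA' : A = A'.
    apply: (subpart_block_eq AP A'P xA).
    exact: (fintype.subsetP BA') (fintype.subsetP AB _ xA).
  suff -> : A = B by [].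
  by apply/eqP; rewrite finset.eqEsubset AB AA'.
move=> P Q /andP[PQ QP]; apply: val_inj; apply/eqP.
by rewrite finset.eqEsubset !sub.
Qed.

End SubpartOrder.

Fact subpart_display : Order.disp_t. Proof. exact: Order.Disp tt tt. Qed.

HB.instance Definition _ (X : finType) :=
  @Order.Le_isPOrder.Build subpart_display (subpart X) (@subpart_le X)
    (@subpart_le_refl X) (@subpart_le_anti X) (@subpart_le_trans X).

Definition underlying (X : finType) (P : subpart X) : {set X} := finset.cover P.

(** The join of a set of subpartitions is built as the partition into classes
    of the relation generated by "lying in a common block of a member of Ps";
    [subpart_joinP] shows that it is the supremum, i.e. the finest common
    coarsening. *)
Section SubpartJoin.
Variables (X : finType) (Ps : set (subpart X)).

Definition joined (x y : X) : bool :=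
  `[< exists2 P, Ps P &
      exists2 B : {set X}, B \in blocks P & (x \in B) && (y \in B) >].

Definition join_blocks : {set {set X}} :=
  equivalence_partition (connect joined) [set x | joined x x]%SET.

Lemma joined_sym : symmetric joined.
Proof.
have H x y : joined x y -> joined y x.
  by case/asboolP=> P PP [B BP] /andP[xB yB]; apply/asboolP;
    exists P => //; exists B => //; rewrite yB.
by move=> x y; apply/idP/idP; apply: H.
Qed.

Lemma join_blocks_equiv :
  {in [set x | joined x x]%SET & &, equivalence_rel (connect joined)}.
Proof.
move=> x y z _ _ _; split=> [|xy]; first exact: connect0.
exact: (same_connect (sym_connect_sym joined_sym) xy z).
Qed.

Fact join_blocksP : finset.partition join_blocks (finset.cover join_blocks).
Proof.
have H := finset.equivalence_partitionP join_blocks_equiv.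
by rewrite (finset.cover_partition H).
Qed.

Definition subpart_join : subpart X := Subpart join_blocksP.

Lemma subpart_joinP : supremums Ps subpart_join.
Proof.
split=> [P PsP | Q Qub].
  apply/subpart_leP => A AP; have [x xA] := subpart_block_ex AP.
  have jA y z : y \in A -> z \in A -> joined y z.
    by move=> yA zA; apply/asboolP; exists P => //; exists A => //; rewrite yA.
  exists [set y in [set x | joined x x] | connect joined x y]%SET.
    by apply/imsetP; exists x; rewrite // inE jA.
  by apply/fintype.subsetP => y yA; rewrite !inE jA //= connect1 // jA.
apply/subpart_leP => A /imsetP[x]; rewrite inE => jx ->.
have Qj y z : joined y z -> exists2 B, B \in blocks Q & (y \in B) && (z \in B).
  case/asboolP=> P /Qub /subpart_leP PQ [C CP /andP[yC zC]].
  have [B BQ /fintype.subsetP CB] := PQ _ CP.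
  by exists B => //; rewrite !CB.
have [B BQ /andP[xB _]] := Qj _ _ jx; exists B => //.
apply/fintype.subsetP => y; rewrite !inE => /andP[_ /connectP[p]].
elim: p x xB {jx} => [|z p IHp] x xB /=; first by move=> _ ->.
case/andP=> /Qj[C CQ /andP[xC zC]] zp; apply: IHp => //.
by rewrite (subpart_block_eq BQ CQ xB xC).
Qed.

Lemma subpart_join_ub P : Ps P -> (P <= subpart_join)%O.
Proof. by case: subpart_joinP => ub _; apply: ub. Qed.

Lemma subpart_join_le Q :
  (forall P, Ps P -> (P <= Q)%O) -> (subpart_join <= Q)%O.
Proof. by case: subpart_joinP => _ lub ubQ; apply: lub. Qed.

End SubpartJoin.

Definition join_over (R : Type) (X : finType) (theta : R -> subpart X)
  (I : set R) : subpart X := subpart_join (theta @` I).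

Lemma join_over_le (R : Type) (X : finType) (theta : R -> subpart X)
  (I J : set R) : I `<=` J -> (join_over theta I <= join_over theta J)%O.
Proof.
move=> IJ; apply: subpart_join_le => _ [t It <-].
by apply: subpart_join_ub; exists t => //; apply: IJ.
Qed.

(** * Formigrams *)

Record formigram (R : realType) (X : finType) := Formigram {
  formigram_fun :> R -> subpart X;
  formigram_tame : exists C : set R,
    [/\ forall t : R, exists2 U, nbhs t U & finite_set (U `&` C),
        forall s t : R, connected_component (~` C) s t ->
          formigram_fun s = formigram_fun t
      & forall c, C c -> exists2 r : R, 0 < r & forall e, 0 <= e < r ->
          (formigram_fun (c - e) <= formigram_fun c)%O /\
          (formigram_fun (c + e) <= formigram_fun c)%O];
  formigram_life : forall x : X, exists I : set R,
    [/\ I !=set0, is_interval I, closed I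
      & forall t, x \in underlying (formigram_fun t) <-> I t] }.

(** The formula for (S_eps theta)(t) makes sense for every map to the lattice
    of subpartitions, as does [block_module]; [join_over_smoothing] identifies
    the associated map on intervals. *)
Definition smoothing (R : realType) (X : finType) (eps : R)
    (theta : R -> subpart X) : R -> subpart X :=
  fun t => join_over theta `[t - eps, t + eps].

(** * The poset Int *)

Record Int (R : realType) := MkInt {
  ends : R * R;
  endsP : ends.1 <= ends.2 }.

HB.instance Definition _ (R : realType) := [isSub for @ends R].
HB.instance Definition _ (R : realType) := [Choice of Int R by <:].

Section IntOrder.
Variable R : realType.

Definition Int_set (I : Int R) : set R := `[(ends I).1, (ends I).2].

Definition Int_le (I J : Int R) : bool :=
  ((ends J).1 <= (ends I).1) && ((ends I).2 <= (ends J).2).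

Lemma Int_le_refl : reflexive Int_le.
Proof. by move=> I; rewrite /Int_le !lexx. Qed.

Lemma Int_le_anti : antisymmetric Int_le.
Proof.
move=> [[b d] /= bd] [[b' d'] /= bd'] /andP[/andP[/= h1 h2] /andP[/= h3 h4]].
by apply: val_inj; congr pair; apply: le_anti; apply/andP; split.
Qed.

Lemma Int_le_trans : transitive Int_le.
Proof.
move=> J I K /andP[h1 h2] /andP[h3 h4].
by apply/andP; split; [apply: le_trans h1 | apply: le_trans h4].
Qed.

Definition point_Int (t : R) : Int R := @MkInt R (t, t) (lexx t).

End IntOrder.

Fact Int_display : Order.disp_t. Proof. exact: Order.Disp tt tt. Qed.

HB.instance Definition _ (R : realType) :=
  @Order.Le_isPOrder.Build Int_display (Int R) (@Int_le R)
    (@Int_le_refl R) (@Int_le_anti R) (@Int_le_trans R).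

Lemma Int_leE (R : realType) (I J : Int R) :
  (I <= J)%O <-> Int_set I `<=` Int_set J.
Proof.
case: I J => [[b d] /= bd] [[b' d'] /= bd']; rewrite /Int_set /=; split.
  case/andP=> /= h1 h2 t /=; rewrite !in_itv /= => /andP[bt td].
  by rewrite (le_trans h1 bt) (le_trans td h2).
move=> H; have /H /= : `[b, d]%classic b by rewrite /= in_itv /= lexx bd.
have /H /= : `[b, d]%classic d by rewrite /= in_itv /= lexx bd.
rewrite !in_itv /= => /andP[_ h2] /andP[h1 _].
by apply/andP; split.
Qed.

Lemma join_over_smoothing (R : realType) (X : finType) (eps : R)
    (theta : R -> subpart X) (I : Int R) : 0 <= eps ->
  join_over (smoothing eps theta) (Int_set I) =
  join_over theta `[(ends I).1 - eps, (ends I).2 + eps].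
Proof.
case: I => [[b d] /= bd] e0; rewrite /Int_set /=.
apply: le_anti; apply/andP; split; apply: subpart_join_le => _ [t + <-].
  rewrite /= in_itv /= => /andP[bt td]; apply: join_over_le => s /=.
  by rewrite !in_itv /= => /andP[h1 h2]; apply/andP; split; lra.
rewrite /= in_itv /= => /andP[bt td].
have [s [sb sd st ts]] : exists s, [/\ b <= s, s <= d, s - eps <= t & t <= s + eps].
  have [tb|tb] := ltP t b; first by exists b; split; lra.
  by have [dt|dt] := ltP d t; [exists d | exists t]; split; lra.
apply: (@le_trans _ _ (smoothing eps theta s)).
  by apply: subpart_join_ub; exists t => //=; rewrite in_itv /= st.
by apply: subpart_join_ub; exists s => //=; rewrite in_itv /= sb.
Qed.

(** * Persistence modules over a poset *)

Record pmodule (F : fieldType) d (P : porderType d) := PModule {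
  pspace :> P -> lmodType F;
  pmap : forall p q : P, (p <= q)%O -> {linear pspace p -> pspace q};
  pmap_id : forall p (pp : (p <= p)%O) v, pmap pp v = v;
  pmap_comp : forall p q r (pq : (p <= q)%O) (qr : (q <= r)%O)
    (pr : (p <= r)%O) v, pmap pr v = pmap qr (pmap pq v) }.

Definition pmodule_iso (F : fieldType) d (P : porderType d)
    (M N : pmodule F P) : Prop :=
  exists f : forall p, {linear M p -> N p},
    (forall p, bijective (f p)) /\
    (forall p q (pq : (p <= q)%O) v, f q (pmap M pq v) = pmap N pq (f p v)).

Record poset_interval d (P : porderType d) := PosetInterval {
  pitv :> set P;
  pitv_nonempty : pitv !=set0;
  pitv_convex : forall p q r, pitv p -> pitv r ->
    (p <= q)%O -> (q <= r)%O -> pitv q;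
  pitv_connected : forall p q, pitv p -> pitv q ->
    exists s : seq P, [/\ forall x, x \in s -> pitv x,
      path (>=<%O) p s & last p s = q] }.

(** Row vectors of length [p \in J] form a copy of F for p in J and the zero
    space otherwise; [pid_mx 1] is the identity matrix when p and q are both
    in J. *)
Section IntervalModule.
Variables (F : fieldType) (d : Order.disp_t) (P : porderType d).
Variable J : poset_interval P.

Definition itv_space (p : P) : lmodType F := 'rV[F]_(p \in pitv J).

Definition itv_map (p q : P) (_ : (p <= q)%O) :
    {linear itv_space p -> itv_space q} :=
  mulmxr (pid_mx 1 : 'M[F]_(p \in pitv J, q \in pitv J)).

Lemma itv_map_id p (pp : (p <= p)%O) v : itv_map pp v = v.
Proof.
rewrite /itv_map /=; move: v; rewrite /itv_space /=.
by case: (p \in pitv J) => v; rewrite ?pid_mx_1 ?mulmx1 // !thinmx0.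
Qed.

Lemma itv_map_comp p q r (pq : (p <= q)%O) (qr : (q <= r)%O)
  (pr : (p <= r)%O) v : itv_map pr v = itv_map qr (itv_map pq v).
Proof.
rewrite /itv_map /= -mulmxA mul_pid_mx.
move: v; rewrite /itv_space /=.
have : p \in pitv J -> r \in pitv J -> q \in pitv J.
  by rewrite !inE => Jp Jr; apply: pitv_convex Jp Jr pq qr.
case: (p \in pitv J); case: (r \in pitv J); case: (q \in pitv J) => H v //=;
  by [move: (H isT isT) | rewrite !thinmx0 | rewrite [v]thinmx0 !mul0mx].
Qed.

Definition interval_module : pmodule F P := PModule itv_map_id itv_map_comp.

End IntervalModule.

(** Direct sum of a family of vector spaces: families with finite support. *)
Record dsum (F : fieldType) (A : Type) (V : A -> lmodType F) := DSum {
  dsum_val :> forall a, V a;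
  dsum_fin : finite_set [set a | dsum_val a <> 0] }.

HB.instance Definition _ F A V := gen_eqMixin (@dsum F A V).
HB.instance Definition _ F A V := gen_choiceMixin (@dsum F A V).

Section DirectSumSpace.
Variables (F : fieldType) (A : Type) (V : A -> lmodType F).
Implicit Types u v w : dsum V.

Lemma dsumP u v : (forall a, u a = v a) -> u = v.
Proof.
case: u v => [f hf] [g hg] /= fg; have {}fg := functional_extensionality_dep fg.
by subst g; congr DSum; apply: Prop_irrelevance.
Qed.

Fact dsum0_fin : finite_set [set a | (0 : V a) <> 0].
Proof. by apply: (@sub_finite_set _ _ set0) => // a /=. Qed.
Definition dsum0 := DSum dsum0_fin.

Fact dsumD_fin u v : finite_set [set a | u a + v a <> 0].
Proof.
have : finite_set ([set a | u a <> 0] `|` [set a | v a <> 0]).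
  by rewrite finite_setU; split; apply: dsum_fin.
apply: sub_finite_set => a /= uv; apply/not_andP => -[ua va].
by apply: uv; rewrite ua va addr0.
Qed.
Definition dsumD u v := DSum (dsumD_fin u v).

Fact dsumZ_fin (k : F) u : finite_set [set a | k *: u a <> 0].
Proof.
apply: (sub_finite_set _ (dsum_fin u)) => a /= ku ua.
by apply: ku; rewrite ua scaler0.
Qed.
Definition dsumZ k u := DSum (dsumZ_fin k u).

Let addA : associative dsumD.
Proof. by move=> u v w; apply: dsumP => a /=; rewrite addrA. Qed.
Let addC : commutative dsumD.
Proof. by move=> u v; apply: dsumP => a /=; rewrite addrC. Qed.
Let add0 : left_id dsum0 dsumD.
Proof. by move=> u; apply: dsumP => a /=; rewrite add0r. Qed.
Let addN : left_inverse dsum0 (dsumZ (-1)) dsumD.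
Proof. by move=> u; apply: dsumP => a /=; rewrite scaleN1r addNr. Qed.

HB.instance Definition _ := GRing.isZmodule.Build (dsum V) addA addC add0 addN.

Let scaleA k l u : dsumZ k (dsumZ l u) = dsumZ (k * l) u.
Proof. by apply: dsumP => a /=; rewrite scalerA. Qed.
Let scale1 : left_id 1 dsumZ.
Proof. by move=> u; apply: dsumP => a /=; rewrite scale1r. Qed.
Let scaleDr : right_distributive dsumZ +%R.
Proof. by move=> k u v; apply: dsumP => a /=; rewrite scalerDr. Qed.
Let scaleDl u : {morph dsumZ^~ u : k l / k + l}.
Proof. by move=> k l; apply: dsumP => a /=; rewrite scalerDl. Qed.

HB.instance Definition _ :=
  GRing.Zmodule_isLmodule.Build F (dsum V) scaleA scale1 scaleDr scaleDl.

End DirectSumSpace.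

Section DirectSumMap.
Variables (F : fieldType) (A : Type) (V W : A -> lmodType F).
Variable f : forall a, {linear V a -> W a}.

Fact dsum_map_fin (u : dsum V) : finite_set [set a | f a (u a) <> 0].
Proof.
apply: (sub_finite_set _ (dsum_fin u)) => a /= fu ua.
by apply: fu; rewrite ua linear0.
Qed.
Definition dsum_map (u : dsum V) : dsum W := DSum (dsum_map_fin u).

Fact dsum_map_linear : linear dsum_map.
Proof. by move=> k u v; apply: dsumP => a /=; rewrite linearP. Qed.

HB.instance Definition _ :=
  GRing.isLinear.Build F (dsum V) (dsum W) _ dsum_map dsum_map_linear.

End DirectSumMap.

Section DirectSum.
Variables (F : fieldType) (d : Order.disp_t) (P : porderType d).
Variables (A : Type) (M : A -> pmodule F P).

Definition direct_sum_space (p : P) : lmodType F := dsum (fun a => M a p).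

Definition direct_sum_map (p q : P) (pq : (p <= q)%O) :
  {linear direct_sum_space p -> direct_sum_space q} :=
  dsum_map (fun a => pmap (M a) pq).

Lemma direct_sum_map_id p (pp : (p <= p)%O) v : direct_sum_map pp v = v.
Proof. by apply: dsumP => a; apply: pmap_id. Qed.

Lemma direct_sum_map_comp p q r (pq : (p <= q)%O) (qr : (q <= r)%O)
  (pr : (p <= r)%O) v :
  direct_sum_map pr v = direct_sum_map qr (direct_sum_map pq v).
Proof. by apply: dsumP => a; apply: pmap_comp. Qed.

Definition direct_sum : pmodule F P :=
  PModule direct_sum_map_id direct_sum_map_comp.

End DirectSum.

(** Multisets are indexed families: a member occurs with multiplicity the
    number of its indices. *)
Definition is_barcode (F : fieldType) d (P : porderType d) (M : pmodule F P)
    (A : Type) (B : A -> poset_interval P) : Prop :=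
  pmodule_iso M (direct_sum (fun a => interval_module F (B a))).

(** * The module of a formigram *)

Section FreeMap.
Variables (F : fieldType) (S T : finType) (f : S -> T).

Definition free_map (v : {ffun S -> F^o}) : {ffun T -> F^o} :=
  [ffun y => \sum_(x | f x == y) v x].

Fact free_map_linear : linear free_map.
Proof.
move=> k u v; apply/ffunP => y; rewrite !ffunE scaler_sumr -big_split /=.
by apply: eq_bigr => x _; rewrite !ffunE.
Qed.

HB.instance Definition _ :=
  GRing.isLinear.Build F {ffun S -> F^o} {ffun T -> F^o} _
    free_map free_map_linear.

End FreeMap.

Section BlockMap.
Variable X : finType.

Definition block (P : subpart X) : finType := {B : {set X} | B \in blocks P}.

Fact block_map_ex (P Q : subpart X) (PQ : (P <= Q)%O) (A : block P) :
  exists B : block Q, sval A \subset sval B.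
Proof.
case: A => A AP; have /subpart_leP/(_ A AP)[B BQ AB] := PQ.
by exists (exist _ B BQ).
Qed.

Definition block_map (P Q : subpart X) (PQ : (P <= Q)%O) (A : block P) :
  block Q := xchoose (block_map_ex PQ A).

Lemma block_mapP (P Q : subpart X) (PQ : (P <= Q)%O) (A : block P)
  (B : block Q) : (block_map PQ A == B) = (sval A \subset sval B).
Proof.
have sub := xchooseP (block_map_ex PQ A); rewrite -/(block_map PQ A) in sub.
apply/eqP/idP => [<-//|AB]; apply: val_inj => /=.
have [x xA] := subpart_block_ex (svalP A).
exact: (subpart_block_eq (svalP (block_map PQ A)) (svalP B)
  (fintype.subsetP sub x xA) (fintype.subsetP AB x xA)).
Qed.

Lemma block_map_id (P : subpart X) (PP : (P <= P)%O) (A : block P) :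
  block_map PP A = A.
Proof. by apply/eqP; rewrite block_mapP. Qed.

Lemma block_map_comp (P Q S : subpart X) (PQ : (P <= Q)%O) (QS : (Q <= S)%O)
  (PS : (P <= S)%O) (A : block P) :
  block_map PS A = block_map QS (block_map PQ A).
Proof.
apply/eqP; rewrite block_mapP.
have AB : sval A \subset sval (block_map PQ A) by rewrite -block_mapP.
by apply: (fintype.subset_trans AB); rewrite -(block_mapP QS).
Qed.

End BlockMap.

Section BlockModule.
Variables (F : fieldType) (R : realType) (X : finType) (theta : R -> subpart X).

Definition Int_join (I : Int R) : subpart X := join_over theta (Int_set I).

Lemma Int_join_le I J : (I <= J)%O -> (Int_join I <= Int_join J)%O.
Proof. by move=> /Int_leE; apply: join_over_le. Qed.

Definition block_space (I : Int R) : lmodType F :=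
  {ffun block (Int_join I) -> F^o}.

Definition block_space_map (I J : Int R) (IJ : (I <= J)%O) :
  {linear block_space I -> block_space J} :=
  @free_map F _ _ (block_map (Int_join_le IJ)).

Lemma block_space_map_id I (II : (I <= I)%O) v : block_space_map II v = v.
Proof.
apply/ffunP => y; rewrite ffunE (big_pred1 y) // => x /=.
by rewrite block_map_id.
Qed.

Lemma block_space_map_comp I J K (IJ : (I <= J)%O) (JK : (J <= K)%O)
  (IK : (I <= K)%O) v :
  block_space_map IK v = block_space_map JK (block_space_map IJ v).
Proof.
apply/ffunP => z; rewrite !ffunE.
under [RHS]eq_bigr do rewrite ffunE.
pose f := block_map (Int_join_le IJ); pose g := block_map (Int_join_le JK).
have fg x : block_map (Int_join_le IK) x = g (f x) by apply: block_map_comp.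
rewrite (partition_big f (fun y => g y == z)) /= => [|x]; last by rewrite fg.
apply: eq_bigr => y /eqP <-; apply: eq_bigl => x; rewrite fg.
by rewrite andbC; case: eqP => [->|]; rewrite ?eqxx.
Qed.

Definition block_module : pmodule F (Int R) :=
  PModule block_space_map_id block_space_map_comp.

End BlockModule.

(** * Zigzag barcodes *)

Definition zz_barcode (R : realType) (A : Type)
    (B : A -> poset_interval (Int R)) : A -> set R :=
  fun a => [set t | pitv (B a) (point_Int t)].

(** Real intervals with a possibly infinite end are written as traces on R of
    intervals of the extended reals; an infinite end is always open. In the
    first case the inequality forces b < +oo and -oo < d. *)
Inductive smoothing_match (R : realType) (eps : R) : set R -> set R -> Prop :=
| match_oo (b d : \bar R) : (b + eps%:E < d - eps%:E)%E ->
    smoothing_match eps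
      (EFin @^-1` `]b, d[) (EFin @^-1` `](b + eps%:E)%E, (d - eps%:E)%E[)
| match_co (b : R) (d : \bar R) : (b%:E < d)%E ->
    smoothing_match eps
      (EFin @^-1` `[b%:E, d[) (EFin @^-1` `[(b - eps)%:E, (d - eps%:E)%E[)
| match_oc (b : \bar R) (d : R) : (b < d%:E)%E ->
    smoothing_match eps
      (EFin @^-1` `]b, d%:E]) (EFin @^-1` `](b + eps%:E)%E, (d + eps)%:E])
| match_cc (b d : R) : b <= d ->
    smoothing_match eps `[b, d] `[b - eps, d + eps].

Definition smoothing_removed (R : realType) (eps : R) (K : set R) : Prop :=
  exists b d : R, b < d <= b + 2 * eps /\ K = `]b, d[%classic.

(* Main.v *)
Require Import Defs.
From HB Require Import structures.
From mathcomp Require Import all_boot all_order all_algebra.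
From mathcomp Require Import all_classical all_reals all_analysis.
From mathcomp Require Import lra.

Import Order.TTheory GRing.Theory Num.Theory.
Import numFieldTopology.Exports numFieldNormedType.Exports.

Local Open Scope classical_set_scope.
Local Open Scope ring_scope.

Set Implicit Arguments.
Unset Strict Implicit.
Unset Printing Implicit Defensive.

(** Write M for the block module of theta. Three properties of M pass to every
    member J of its barcode: M(I) is generated by the M([t,t]) with t in I; the
    square of [y,y], [x,y], [y,z] and [x,z] is a pushout, because a point alive
    in both [x,y] and [y,z] is alive at y; and M([t,t]) -> M(I) is an isomorphism
    for t in I when I is short enough. They force the diagonal of J to be a real
    interval K, and J to consist of the closed intervals that meet K and contain
    no open end of K. The block module of the smoothing at I is M at the
    thickening of I by eps, so it is the sum of the interval modules of the sets
    of those I whose thickening lies in J. Such a set is empty exactly when K is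
    a bounded open interval of length at most 2 eps, and otherwise it is an
    interval whose diagonal is read off the description of J. Uniqueness of
    interval decompositions concludes. *)

(* [seq.pmap] shadows the structure maps of [pmodule]. *)
Local Notation pmap := Defs.pmap.

(** * Coordinates of a module with a barcode *)

(* An isomorphism of M with the sum of the interval modules of the B a, with the
   row vectors of length [p \in B a] traded for scalars to avoid dependent types. *)
Record coordinates (F : fieldType) d (P : porderType d) (M : pmodule F P)
    (A : Type) (B : A -> set P) := Coordinates {
  coord : forall p : P, A -> M p -> F^o;
  unitv : forall p : P, A -> M p;
  coord_linear : forall p a, linear (@coord p a);
  coord_out : forall p a v, ~ B a p -> @coord p a v = 0;
  unitv_out : forall p a, ~ B a p -> unitv p a = 0;
  coord_unitv : forall p a, B a p -> coord a (unitv p a) = 1;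
  coord_unitv_neq : forall p a b, a <> b -> coord a (unitv p b) = 0;
  coord_pmap : forall p q (pq : (p <= q)%O) a v,
    B a q -> coord a (pmap M pq v) = coord a v;
  unitv_pmap : forall p q (pq : (p <= q)%O) a,
    B a p -> pmap M pq (unitv p a) = unitv q a;
  coord_eq0 : forall p (v : M p), (forall a, coord a v = 0) -> v = 0;
  coord_fin : forall p (v : M p), finite_set [set a | coord a v <> 0] }.

Section CoordLinear.
Variables (F : fieldType) (d : Order.disp_t) (P : porderType d).
Variables (M : pmodule F P) (A : Type) (B : A -> set P).
Variables (c : coordinates M B) (p : P) (a : A).

HB.instance Definition _ := GRing.isLinear.Build F (M p) F^o _
  (@coord _ _ _ _ _ _ c p a) (@coord_linear _ _ _ _ _ _ c p a).

End CoordLinear.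

(** * Coordinates from a barcode *)

Section CoordinatesOfBarcode.
Variables (F : fieldType) (d : Order.disp_t) (P : porderType d).
Variables (A : Type) (B : A -> poset_interval P).

(** On rows of length at most 1 this identifies the space with F or 0, with no case distinction on
    the boolean length. *)
Definition total (n : nat) (v : 'rV[F]_n) : F^o := \sum_j v 0 j.

Lemma total_linear n : linear (@total n).
Proof.
move=> k u v; rewrite /total scaler_sumr -big_split /=.
by apply: eq_bigr => j _; rewrite !mxE.
Qed.

Lemma total_eq0 (b : bool) (v : 'rV[F]_b) : total v = 0 -> v = 0.
Proof.
case: b v => v; last by rewrite thinmx0.
by rewrite /total big_ord1 => v0; apply/rowP => j; rewrite ord1 v0 mxE.
Qed.

Lemma row_false_eq (b : bool) (v w : 'rV[F]_b) : b = false -> v = w.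
Proof. by case: b v w => // v w _; rewrite [v]thinmx0 [w]thinmx0. Qed.

Lemma total_const1 : total (const_mx 1 : 'rV[F]_true) = 1.
Proof. by rewrite /total big_ord1 mxE. Qed.

Lemma total_itv_map (J : poset_interval P) p q (pq : (p <= q)%O)
    (v : itv_space F J p) : pitv J q -> total (itv_map F J pq v) = total v.
Proof.
move=> /mem_set Jq; rewrite /itv_map /=; move: v; rewrite /itv_space /=.
rewrite Jq; case: (p \in pitv J) => v; rewrite ?pid_mx_1 ?mulmx1 //.
by rewrite [v]thinmx0 mul0mx /total big_ord0 big1 // => j _; rewrite mxE.
Qed.

Let D := direct_sum (fun a => interval_module F (B a)).

Fact dunit_fin (p : P) (b : A) : finite_set [set a |
  (if pselect (a = b) then const_mx 1 else 0 : interval_module F (B a) p) <> 0].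
Proof.
apply: (@sub_finite_set _ _ [set b]); last exact: finite_set1.
by move=> a /=; case: pselect.
Qed.

(** Outside [B b] the constant row has length 0, so the generator is then the zero vector. *)
Definition dunit (p : P) (b : A) : D p := DSum (dunit_fin p b).

Lemma dunit_map p q (pq : (p <= q)%O) a :
  pitv (B a) p -> pmap D pq (dunit p a) = dunit q a.
Proof.
move=> Bp; apply: dsumP => b; rewrite /=.
case: pselect => [ba|ba] /=; last by rewrite mul0mx.
subst b; move/mem_set: Bp => Bp; rewrite Bp; case: (q \in _); last by rewrite !thinmx0.
by rewrite pid_mx_1 mulmx1.
Qed.

Lemma barcode_coordinates (M : pmodule F P) :
  is_barcode M B -> inhabited (coordinates M (fun a => pitv (B a))).
Proof.
case=> f [fbij fnat].
have [g gK Kg] : exists2 g : forall p, D p -> M p,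
    (forall p, cancel (f p) (g p)) & (forall p, cancel (g p) (f p)).
  have H p : {g : D p -> M p | cancel (f p) g /\ cancel g (f p)}.
    by apply: cid; case: (fbij p) => g; exists g.
  by exists (fun p => sval (H p)) => p; case: (svalP (H p)).
have outE p a : ~ pitv (B a) p -> p \in pitv (B a) = false.
  by move=> Bp; apply/negP => /set_mem.
constructor.
apply: (@Coordinates F d P M A _
  (fun p a v => total (dsum_val (f p v) a)) (fun p a => g p (dunit p a))).
- by move=> p a k u v; rewrite linearP /= total_linear.
- move=> p a v /outE E; move: (dsum_val _ _) => /=; rewrite /itv_space E => w.
  by rewrite /total big_ord0.
- move=> p a /outE E; apply: (can_inj (gK p)); rewrite Kg linear0.
  apply: dsumP => b /=; case: pselect => // ba; subst b => /=.
  exact: row_false_eq E.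
- move=> p a /mem_set E; rewrite Kg /=; case: pselect => //= _.
  by rewrite E total_const1.
- move=> p a b ab; rewrite Kg /=; case: pselect => //= _.
  by rewrite /total big1 // => j _; rewrite mxE.
- move=> p q pq a v Bq; rewrite fnat.
  exact: (@total_itv_map (B a) p q pq).
- move=> p q pq a Bp; apply: (can_inj (gK q)).
  by rewrite fnat !Kg dunit_map.
- move=> p v v0; apply: (can_inj (gK p)); rewrite linear0.
  by apply: dsumP => a; apply: total_eq0; apply: v0.
- move=> p v; apply: (sub_finite_set _ (dsum_fin (f p v))) => a /= t0 f0.
  by apply: t0; rewrite f0 /total big1 // => j _; rewrite mxE.
Qed.

End CoordinatesOfBarcode.

(** * Uniqueness of barcodes *)

(** Connectedness as induction along a zigzag of comparable members. *)
Lemma poset_interval_ind d (P : porderType d) (J : poset_interval P)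
    (Q : P -> Prop) p q : pitv J p -> pitv J q -> Q p ->
  (forall x y, pitv J x -> pitv J y -> (x >=< y)%O -> Q x -> Q y) -> Q q.
Proof.
move=> Jp Jq Qp step; have [s [sJ sp <-]] := pitv_connected Jp Jq.
elim: s p Jp Qp sJ sp {Jq q} => [//|x s IH] p Jp Qp sJ /= /andP[px xs].
have Jx : pitv J x by apply: sJ; rewrite inE eqxx.
apply: IH xs => //; first exact: step px Qp.
by move=> y ys; apply: sJ; rewrite inE ys orbT.
Qed.

(** * Coefficients between two decompositions *)

Section CrossCoordinates.
Variables (F : fieldType) (d : Order.disp_t) (P : porderType d).
Variables (M : pmodule F P) (A A' : Type).
Variables (B : A -> poset_interval P) (B' : A' -> poset_interval P).
Variables (c : coordinates M (fun a => pitv (B a))).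
Variables (c' : coordinates M (fun a => pitv (B' a))).
Variables (a1 a2 : A) (a' : A').
Hypothesis a12 : pitv (B a1) = pitv (B a2).

Let phi p := coord c' a' (unitv c p a1).
Let psi p := coord c a2 (unitv c' p a').

(** Naturality moves both factors from p to q while a' is alive at both. If a' is dead at q, its
    generator at p goes to 0, so [psi p] vanishes; if it is dead at p, [phi p] vanishes. *)
Lemma cross_le p q : (p <= q)%O -> pitv (B a1) p -> pitv (B a1) q ->
  phi p * psi p = phi q * psi q.
Proof.
move=> pq Jp Jq; have J2q : pitv (B a2) q by rewrite -a12.
have [B'q|B'q] := pselect (pitv (B' a') q); last first.
  have -> : phi q = 0 by rewrite /phi coord_out.
  case: (pselect (pitv (B' a') p)) => B'p; last first.
    by rewrite /phi coord_out ?mul0r.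
  by rewrite /psi -(coord_pmap c pq _ J2q) unitv_pmap // unitv_out // linear0 mulr0 mul0r.
have -> : phi q = phi p by rewrite /phi -(coord_pmap c' pq _ B'q) unitv_pmap.
case: (pselect (pitv (B' a') p)) => B'p; last by rewrite /phi coord_out ?mul0r.
by rewrite /psi -(coord_pmap c pq _ J2q) unitv_pmap.
Qed.

(* The composite of module maps k_J -> k_J' -> k_J is a scalar on the connected
   set J; where it is nonzero J and J' meet, and neither can leave the other
   along a comparability without forcing this scalar to vanish. *)
Lemma cross_neq0 p : phi p * psi p <> 0 -> pitv (B' a') = pitv (B a1).
Proof.
move=> t0.
have Jp : pitv (B a1) p.
  by apply: contrapT => Jp; apply: t0; rewrite /phi unitv_out // linear0 mul0r.
have tq q : pitv (B a1) q -> phi q * psi q <> 0.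
  move=> Jq; apply: (@poset_interval_ind _ _ (B a1)
    (fun q => phi q * psi q <> 0) p q Jp Jq t0) => x y Jx Jy.
  by case/orP => xy; rewrite (cross_le xy).
have JJ' q : pitv (B a1) q -> pitv (B' a') q.
  move=> /tq; apply: contra_notP => J'q.
  by rewrite /phi coord_out // mul0r.
apply/seteqP; split => [q J'q|]; last exact: JJ'.
apply: (@poset_interval_ind _ _ (B' a') (pitv (B a1)) p q (JJ' _ Jp) J'q Jp) => x y J'x J'y xy Jx.
apply: contrapT => Jy; case/orP: xy => [xy|yx]; apply: (tq x Jx).
  rewrite /phi -(coord_pmap c' xy _ J'y) unitv_pmap //.
  by rewrite [unitv c y a1]unitv_out // linear0 mul0r.
rewrite /psi -(unitv_pmap c' yx) // coord_pmap -?a12 //.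
by rewrite [coord c a2 _]coord_out -?a12 // mulr0.
Qed.

End CrossCoordinates.

(** * Comparison of multiplicities *)

Section Uniqueness.
Variables (F : fieldType) (d : Order.disp_t) (P : porderType d).
Variables (M : pmodule F P) (A A' : choiceType).
Variables (B : A -> poset_interval P) (B' : A' -> poset_interval P).
Variables (c : coordinates M (fun a => pitv (B a))).
Variables (c' : coordinates M (fun a => pitv (B' a))).

Lemma coordinates_expand p (s : seq A') (v : M p) : uniq s ->
  (forall a, pitv (B' a) p -> a \in s) ->
  v = \sum_(a <- s) coord c' a v *: unitv c' p a.
Proof.
move=> us ms; apply/eqP; rewrite -subr_eq0; apply/eqP.
apply: (@coord_eq0 F d P M A' _ c' p) => a; rewrite linearB /= linear_sum /=.
have [Ba|Ba] := pselect (pitv (B' a) p); last first.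
  by rewrite coord_out // big1 ?subr0 // => b _; rewrite coord_out.
rewrite (bigD1_seq a) ?ms //= linearZ /= coord_unitv //.
rewrite big1 ?addr0; first by rewrite [_ *: _]mulr1 subrr.
move=> b ba; rewrite linearZ /= coord_unitv_neq ?scaler0 //.
by apply/eqP; rewrite eq_sym.
Qed.

(** Expand at p a generator of type J in the other decomposition and return: by [cross_neq0] only
    members equal to J contribute. Hence [Psi *m Phi] is the identity, which bounds the number of
    rows of [Psi] by its number of columns. *)
Lemma multiplicity_le (J : set P) (sA : seq A) (sA' : seq A') p :
  J p -> finite_set [set a | pitv (B' a) p] ->
  uniq sA -> (forall a, a \in sA -> pitv (B a) = J) ->
  uniq sA' -> (forall a, pitv (B' a) = J -> a \in sA') ->
  (size sA <= size sA')%N.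
Proof.
move=> Jp /finite_seqP[s0 s0E] uA mA uA' mA'.
(* [sA'] comes first and the added members all differ from J, so the expansion splits into the
   matrix product and vanishing terms. *)
pose s := sA' ++ [seq a <- undup s0 | a \notin sA'].
have us : uniq s.
  rewrite cat_uniq uA' filter_uniq ?undup_uniq // andbT /=.
  by apply/hasPn => a; rewrite mem_filter => /andP[].
have ms a : pitv (B' a) p -> a \in s.
  move=> Ba; have : [set a | pitv (B' a) p] a by [].
  by rewrite s0E mem_cat mem_filter mem_undup => /= ->; rewrite andbT orbN.
pose a k := tnth (in_tuple sA) k; pose a' i := tnth (in_tuple sA') i.
have aJ k : pitv (B (a k)) = J by apply: mA; apply: mem_tnth.
pose Psi : 'M[F]_(size sA, size sA') :=
  \matrix_(k, i) coord c (a k) (unitv c' p (a' i)).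
pose Phi : 'M[F]_(size sA', size sA) :=
  \matrix_(i, k) coord c' (a' i) (unitv c p (a k)).
suff : Psi *m Phi = 1%:M by apply: mulmx1_min.
apply/matrixP => k l; rewrite !mxE.
have <- : coord c (a k) (unitv c p (a l)) = (k == l)%:R.
  have [->|kl] := eqVneq k l; first by rewrite coord_unitv // aJ.
  rewrite coord_unitv_neq // => akl; case/eqP: kl; apply: val_inj => /=.
  apply/eqP; rewrite -(nth_uniq (a k) _ _ uA) //; apply/eqP.
  by move: akl; rewrite [a k in LHS](tnth_nth (a k)) [a l](tnth_nth (a k)).
rewrite [in RHS](coordinates_expand (unitv c p (a l)) us ms) linear_sum /=.
rewrite big_cat /= [X in _ = _ + X]big1_seq ?addr0.
  rewrite [RHS]big_tnth; apply: eq_bigr => i _; rewrite !mxE linearZ /=.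
  by rewrite mulrC.
move=> b /andP[_]; rewrite mem_filter => /andP[/negP bJ _].
rewrite linearZ /=; apply: contrapT => t0; apply: bJ; apply: mA'.
rewrite -(aJ l); apply: cross_neq0 t0.
by rewrite !aJ.
Qed.

End Uniqueness.

(** [s k] and [s' k] enumerate the fibres over k; an element goes to the one at the same position in
    the other fibre. *)
Lemma fiber_bijection (T T' : choiceType) (K : Type) (h : T -> K) (h' : T' -> K)
    (s : K -> seq T) (s' : K -> seq T') :
  (forall k, uniq (s k)) -> (forall k, uniq (s' k)) ->
  (forall a, a \in s (h a)) -> (forall a, a \in s' (h' a)) ->
  (forall k a, a \in s k -> h a = k) -> (forall k a, a \in s' k -> h' a = k) ->
  (forall k, size (s k) = size (s' k)) ->
  exists2 f : T -> T', bijective f & forall a, h' (f a) = h a.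
Proof.
move=> us us' ms ms' hs hs' ss'.
have step (T1 T2 : choiceType) (h1 : T1 -> K) (h2 : T2 -> K) (s1 : K -> seq T1)
    (s2 : K -> seq T2) (ms1 : forall a, a \in s1 (h1 a))
    (us2 : forall k, uniq (s2 k)) (hs2 : forall k a, a \in s2 k -> h2 a = k)
    (s12 : forall k, size (s1 k) = size (s2 k)) a :
    exists b, h2 b = h1 a /\ index b (s2 (h1 a)) = index a (s1 (h1 a)).
  have : (index a (s1 (h1 a)) < size (s2 (h1 a)))%N by rewrite -s12 index_mem.
  case E: (s2 (h1 a)) => [//|b0 s0]; rewrite -E => lt.
  exists (nth b0 (s2 (h1 a)) (index a (s1 (h1 a)))).
  by split; [apply: hs2; apply: mem_nth | rewrite index_uniq].
have [f fP] := choice (step _ _ h h' s s' ms us' hs' ss').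
have [g gP] := choice (step _ _ h' h s' s ms' us hs (fun k => esym (ss' k))).
exists f => [|a]; last by case: (fP a).
exists g => [a|b].
  have [hf If] := fP a; have [hg Ig] := gP (f a); rewrite hf in hg Ig.
  have ga : g (f a) \in s (h a) by rewrite -hg.
  by rewrite -(nth_index a ga) Ig If nth_index.
have [hg Ig] := gP b; have [hf If] := fP (g b); rewrite hg in hf If.
have fb : f (g b) \in s' (h' b) by rewrite -hf.
by rewrite -(nth_index b fb) If Ig nth_index.
Qed.

(** [multiplicity_le] in both directions equates the multiplicities of each J, and [fiber_bijection]
    matches the members. *)
Theorem coordinates_bijection (F : fieldType) d (P : porderType d)
    (M : pmodule F P) (A A' : Type)
    (B : A -> poset_interval P) (B' : A' -> poset_interval P) :
  coordinates M (fun a => pitv (B a)) -> coordinates M (fun a => pitv (B' a)) ->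
  (forall p, finite_set [set a | pitv (B a) p]) ->
  (forall p, finite_set [set a | pitv (B' a) p]) ->
  exists2 f : A -> A', bijective f & forall a, pitv (B' (f a)) = pitv (B a).
Proof.
move=> c c' fin fin'.
have enum (T : choiceType) (C : T -> poset_interval P) :
    (forall p, finite_set [set a | pitv (C a) p]) ->
    exists s : set P -> seq T, forall J,
      uniq (s J) /\ forall a, a \in s J <-> pitv (C a) = J.
  move=> finC.
  suff H J : exists s : seq T, uniq s /\ forall a, a \in s <-> pitv (C a) = J.
    by have [s sP] := choice H; exists s.
  have [[a0 a0J]|noa] := pselect (exists a, pitv (C a) = J); last first.
    by exists [::]; split => // a; split => // aJ; case: noa; exists a.
  (* The fibre over J is finite because all its members contain p. *)
  have [p Jp] := pitv_nonempty (C a0); rewrite a0J in Jp.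
  have /finite_seqP[s sE] : finite_set [set a | pitv (C a) = J].
    by apply: sub_finite_set (finC p) => a /= ->.
  exists (undup s); split; first exact: undup_uniq.
  move=> a; rewrite mem_undup; have -> : (a \in s : Prop) = [set` s] a by [].
  by rewrite -sE.
have [s sP] := enum {classic A} B fin.
have [s' sP'] := enum {classic A'} B' fin'.
apply: (@fiber_bijection {classic A} {classic A'} (set P)
  (fun a => pitv (B a)) (fun a => pitv (B' a)) s s').
- by move=> J; case: (sP J).
- by move=> J; case: (sP' J).
- by move=> a; case: (sP (pitv (B a))) => _ ->.
- by move=> a; case: (sP' (pitv (B' a))) => _ ->.
- by move=> J a; case: (sP J) => _ ->.
- by move=> J a; case: (sP' J) => _ ->.
move=> J; have [u m] := sP J; have [u' m'] := sP' J.
have [[p Jp]|J0] := pselect (exists p, J p).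
  apply/eqP; rewrite eqn_leq; apply/andP; split.
    apply: (@multiplicity_le F d P M {classic A} {classic A'} B B' c c' J _ _ p) => //.
    - by move=> a /m.
    - by move=> a /m'.
  apply: (@multiplicity_le F d P M {classic A'} {classic A} B' B c' c J _ _ p) => //.
  - by move=> a /m'.
  - by move=> a /m.
have nil (T : eqType) (C : T -> poset_interval P) (r : seq T) :
    (forall a, a \in r -> pitv (C a) = J) -> r = [::].
  case: r => // a r H; case: J0; have [p Cp] := pitv_nonempty (C a).
  by exists p; rewrite -(H a) // inE eqxx.
have -> : s J = [::] by apply: (nil _ (B : {classic A} -> _)) => a /m.
by have -> : s' J = [::] by apply: (nil _ (B' : {classic A'} -> _)) => a /m'.
Qed.

(** * The shape of a block *)

(** [j s t] stands for the closed interval from s to t lying in J. [block_glue] and the two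
    extension fields come from the pushout squares, [block_near] from the isomorphisms on short
    intervals, [block_diag] from connectedness. *)
Record block_axioms (R : realType) (j : R -> R -> Prop) : Prop := BlockAxioms {
  block_convex : forall s t s' t' x y, j s t -> j s' t' ->
    s' <= x -> x <= s -> t <= y -> y <= t' -> j x y;
  block_gen : forall s t, j s t -> exists x, [/\ s <= x, x <= t & j x x];
  block_glue : forall x y z, j x y -> j y z -> j y y /\ j x z;
  block_extendl : forall x y z, x <= y -> j y z -> ~ j x z -> j y y;
  block_extendr : forall x y z, y <= z -> j x y -> ~ j x z -> j y y;
  block_near : forall t, exists2 r, 0 < r & forall s s',
    t - r < s -> s <= t -> t <= s' -> s' < t + r -> (j s s' <-> j t t);
  block_diag : forall x y z, j x x -> j z z -> x <= y -> y <= z -> j y y }.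

(** Reflection of the line, which carries results on left ends over to right ends. *)
Definition mirror (R : realType) (j : R -> R -> Prop) s t := j (- t) (- s).

Lemma mirror_axioms (R : realType) (j : R -> R -> Prop) :
  block_axioms j -> block_axioms (mirror j).
Proof.
move=> H; split; rewrite /mirror.
- move=> s t s' t' x y h h' *.
  by apply: (block_convex H h h'); rewrite lerN2.
- move=> s t /(block_gen H)[x [tx xs jx]]; exists (- x).
  by rewrite !opprK; split=> //; lra.
- by move=> x y z h h'; have [? ?] := block_glue H h' h.
- by move=> x y z xy h; apply: (block_extendr H) => //; rewrite lerN2.
- by move=> x y z xy h; apply: (block_extendl H) => //; rewrite lerN2.
- move=> t; have [r r0 hr] := block_near H (- t); exists r => // s s' *.
  by apply: hr; lra.
by move=> x y z hx hz *; apply: (block_diag H hz hx); rewrite lerN2.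
Qed.

(** * Convexity of the diagonal and behaviour at a left end *)

Section BlockHalf.
Variables (R : realType) (j : R -> R -> Prop).
Hypothesis H : block_axioms j.

(** Take the supremum of the x with [w,x] in J. Short intervals around it are in J by [block_near],
    and [block_glue] appends them: the supremum is attained and cannot stop before v. *)
Lemma block_hull w v : j w w -> j v v -> w <= v -> j w v.
Proof.
move=> jw jv wv; pose T : set R := [set x | [/\ w <= x, x <= v & j w x]].
have Tw : T w by split.
have supT : has_sup T by split; [exists w | exists v => x []].
have [x0w x0v] : w <= sup T /\ sup T <= v.
  split; first by apply: ub_le_sup => //; case: supT.
  by apply: ge_sup; [exists w | move=> x []].
have j0 : j (sup T) (sup T) by apply: (block_diag H jw jv).
have [r r0 near0] := block_near H (sup T).
have [x [wx xv jwx] x0] : exists2 x, T x & sup T - r < x.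
  by have [x Tx ?] := sup_adherent r0 supT; exists x.
have xle : x <= sup T by apply: ub_le_sup => //; case: supT.
have jx0 : j x (sup T) by apply/near0 => //; lra.
have [_ jw0] := block_glue H jwx jx0.
have [vr|rv] := ltP v (sup T + r).
  have : j (sup T) v by apply/near0 => //; lra.
  by case/(block_glue H jw0).
have : j (sup T) (sup T + r / 2) by apply/near0 => //; lra.
case/(block_glue H jw0) => _ jwr.
suff : sup T + r / 2 <= sup T by lra.
by apply: ub_le_sup; [case: supT | split=> //; lra].
Qed.

(** If s <= b, then for w slightly above b the interval [b,w] lies between [w,w] and [s,t], so it is
    in J, and [block_near] puts [b,b] in J. *)
Lemma block_open_left b v s t : ~ j b b -> b < v ->
  (forall x, b < x -> x <= v -> j x x) -> (forall x, j x x -> b < x) ->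
  j s t -> b < s.
Proof.
move=> jb bv bvj Kb jst; rewrite ltNge; apply/negP => sb.
have [u [su ut ju]] := block_gen H jst.
have [r r0 near_b] := block_near H b.
have bu := Kb _ ju.
(* w <= u keeps [b,w] inside [s,t], w <= v puts [w,w] in J, and w < b + r lets [block_near]
   apply. *)
pose w := Num.min (Num.min u v) (b + r / 2).
have [wu [wv [wr bw]]] : w <= u /\ w <= v /\ w <= b + r / 2 /\ b < w.
  by rewrite /w !ge_min !lt_min !lexx ?orbT /= bu bv; do !split => //; lra.
apply: jb; apply/(near_b b w); [lra|lra|lra|lra|].
by apply: (block_convex H (bvj w bw wv) jst); lra.
Qed.

(** It suffices to have [p,b] in J, by gluing. Otherwise the short interval from b - r/2 to b, which
    is in J, would by [block_extendl] put a point below b on the diagonal. *)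
Lemma block_closed_left b p q : j b b -> (forall x, j x x -> b <= x) ->
  j b q -> p <= b -> j p q.
Proof.
move=> jb Kb jbq pb; suff jpb : j p b by case: (block_glue H jpb jbq).
have [r r0 near_b] := block_near H b.
have [pr|pr] := ltP (b - r) p; first by apply/near_b => //; lra.
apply: contrapT => npb.
have jr : j (b - r / 2) b by apply/near_b => //; lra.
have : j (b - r / 2) (b - r / 2) by apply: (block_extendl H _ jr npb); lra.
by move/Kb; lra.
Qed.

End BlockHalf.

Definition lower_cond (R : realType) (lo : itv_bound R) (s t : R) : bool :=
  match lo with
  | BSide true b => b <= t
  | BSide false b => b < s
  | BInfty c => c
  end.

(** As an upper bound [BSide true d] is an open end and [BSide false d] a closed one, the reverse of
    [lower_cond]. *)
Definition upper_cond (R : realType) (hi : itv_bound R) (s t : R) : bool :=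
  match hi with
  | BSide true d => t < d
  | BSide false d => s <= d
  | BInfty c => ~~ c
  end.

(* A closed end of the interval of the x with [j x x] must only be met, an open
   end must be avoided. *)
Lemma block_shape (R : realType) (j : R -> R -> Prop) : block_axioms j ->
  (exists x, j x x) ->
  exists lo hi : itv_bound R,
    (forall x, j x x <-> x \in Interval lo hi) /\
    forall s t, s <= t -> (j s t <-> lower_cond lo s t && upper_cond hi s t).
Proof.
move=> H [x0 jx0]; have H' := mirror_axioms H.
have /is_intervalP KE : is_interval [set x | j x x].
  by move=> x z /= jx jz y /andP[xy yz]; apply: block_diag H _ _ _ jx jz xy yz.
case: (Rhull _) KE => lo hi KE; exists lo, hi.
have K x : j x x <-> x \in Interval lo hi.
  by have -> : j x x = [set x | j x x] x by []; rewrite KE.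
split=> // s t st; split.
  (* A generating point x settles a closed end; an open end needs [block_open_left], mirrored on the
     right. *)
  move=> jst; have [x [sx xt /K]] := block_gen H jst.
  rewrite itv_boundlr => /andP[lox xhi]; apply/andP; split.
    case: lo K lox {KE} => [[] b|[]] //= K; rewrite bnd_simp => bx; first lra.
    have /K := jx0; rewrite itv_boundlr /= bnd_simp => /andP[bx0 x0hi].
    apply: (block_open_left H _ bx0 _ _ jst).
    - by move/K; rewrite itv_boundlr /= bnd_simp ltxx.
    - move=> y by_ yx0; apply/K; rewrite itv_boundlr /= bnd_simp by_ /=.
      by apply: le_trans x0hi; rewrite bnd_simp.
    - by move=> y /K; rewrite itv_boundlr /= bnd_simp => /andP[].
  case: hi K xhi {KE} => [[] d|[]] //= K; rewrite bnd_simp => xd; last lra.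
  have /K := jx0; rewrite itv_boundlr /= bnd_simp => /andP[lox0 x0d].
  rewrite -ltrN2; apply: (block_open_left H' (v := - x0) (t := - s)).
  - by rewrite /mirror opprK => /K; rewrite itv_boundlr /= bnd_simp ltxx andbF.
  - by rewrite ltrN2.
  - move=> y dy yx0; apply/K; rewrite itv_boundlr /= bnd_simp ltrNl dy andbT.
    by apply: le_trans lox0 _; rewrite bnd_simp lerNr.
  - by move=> y; rewrite /mirror => /K; rewrite itv_boundlr /= bnd_simp ltrNl => /andP[].
  - by rewrite /mirror !opprK.
case/andP => L U.
(* Ends beyond a closed end of K are moved back to it. Then s' and t' lie in K, [block_hull] gives
   [s',t'], and [block_closed_left] on each side restores s and t. *)
pose s' := if lo is BSide true b then Num.max s b else s.
pose t' := if hi is BSide false d then Num.min t d else t.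
have /K := jx0; rewrite itv_boundlr => /andP[lox0 x0hi] {KE}.
have [ss' tt' st' js' jt'] :
    [/\ s <= s', t' <= t, s' <= t', j s' s' & j t' t'].
  rewrite /s' /t'; split; try apply/K; rewrite ?itv_boundlr;
  case: (lo) L lox0 => [[] b|[]] //= L; case: (hi) U x0hi => [[] d|[]] //= U;
  rewrite ?bnd_simp => *; rewrite ?andbT;
  try case: (leP s b) => ?; try case: (leP t d) => ?;
  try (apply/andP; split); lra.
have js't' := block_hull H js' jt' st'.
have jst' : j s t'.
  move: js't' js' ss'; rewrite /s'.
  case: lo K {L lox0 s' st'} => [[] b|[]] //= K.
  rewrite maxEle; case: ifP => sb //; move=> jbt' jb _.
  apply: (block_closed_left H jb) => //.
  by move=> x /K; rewrite itv_boundlr /= bnd_simp => /andP[].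
move: jst' jt' tt'; rewrite /t'.
case: hi K {U x0hi t' st' js't'} => [[] d|[]] //= K.
rewrite minEle; case: ifP => // /negbT; rewrite -ltNge => dt jsd jd _.
rewrite -[s]opprK -[t]opprK; apply: (block_closed_left H' (b := - d)).
- by rewrite /mirror opprK.
- by move=> x /K; rewrite itv_boundlr /= bnd_simp lerNl => /andP[].
- by rewrite /mirror !opprK.
- by rewrite lerN2 ltW.
Qed.

(** * Pushouts of subpartitions *)

Section FreeBasis.
Variables (F : fieldType) (S T : finType).

Definition basisv (U : finType) (A : U) : {ffun U -> F^o} := [ffun x => (x == A)%:R].

Lemma ffun_expand (u : {ffun S -> F^o}) : u = \sum_A u A *: basisv A.
Proof.
apply/ffunP => x; rewrite sum_ffunE (bigD1 x) //= big1 ?addr0.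
  by rewrite !ffunE eqxx [_ *: _]mulr1.
by move=> y yx; rewrite !ffunE eq_sym (negbTE yx) scaler0.
Qed.

Lemma free_map_basisv (f : S -> T) A : free_map f (basisv A) = basisv (f A).
Proof.
apply/ffunP => y; rewrite !ffunE; under eq_bigr do rewrite ffunE.
case: (eqVneq y (f A)) => [->|yA].
  rewrite (bigD1 A) //= eqxx big1 ?addr0 // => x /andP[_ /negbTE ->] //.
rewrite big1 // => x /eqP fx; case: eqP => // xA.
by rewrite -fx xA eqxx in yA.
Qed.

(** Pushing forward along f is adjoint to composing with f. *)
Lemma free_map_sum (f : S -> T) (u : {ffun S -> F^o}) (g : T -> F) :
  \sum_y free_map f u y * g y = \sum_x u x * g (f x).
Proof.
rewrite [RHS](partition_big f xpredT) //=; apply: eq_bigr => y _.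
by rewrite ffunE mulr_suml; apply: eq_bigr => x /eqP ->.
Qed.

End FreeBasis.

Section SubpartPushout.
Variable X : finType.
Implicit Types P Q S T : subpart X.

Lemma underlyingP P x :
  reflect (exists A : block P, x \in sval A) (x \in underlying P).
Proof.
apply: (iffP finset.bigcupP) => [[A AP xA]|[[A AP] xA]].
  by exists (exist _ A AP).
by exists A.
Qed.

Lemma underlying_le P Q x : (P <= Q)%O -> x \in underlying P -> x \in underlying Q.
Proof.
move=> PQ /underlyingP[A xA]; apply/underlyingP; exists (block_map PQ A).
have : sval A \subset sval (block_map PQ A) by rewrite -block_mapP.
by move/fintype.subsetP/(_ x xA).
Qed.

Lemma block_inj P (A B : block P) x : x \in sval A -> x \in sval B -> A = B.
Proof. by move=> xA xB; apply: val_inj; apply: subpart_block_eq (svalP A) (svalP B) xA xB. Qed.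

Lemma block_map_mem P Q (PQ : (P <= Q)%O) (A : block P) x :
  x \in sval A -> x \in sval (block_map PQ A).
Proof.
have : sval A \subset sval (block_map PQ A) by rewrite -block_mapP.
by move/fintype.subsetP => H /H.
Qed.

Lemma underlying_join (Ps : set (subpart X)) x :
  x \in underlying (subpart_join Ps) -> exists2 P, Ps P & x \in underlying P.
Proof.
have := finset.equivalence_partitionP (@join_blocks_equiv X Ps).
move/finset.cover_partition => E; rewrite /underlying /= E inE.
case/asboolP => P PsP [B BP /andP[xB _]]; exists P => //.
by apply/finset.bigcupP; exists B.
Qed.

Section Pushout.
Variables (V : eqType) (v0 : V) (P Q S T : subpart X).
Variables (SP : (S <= P)%O) (SQ : (S <= Q)%O) (PT : (P <= T)%O) (QT : (Q <= T)%O).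
Hypothesis T_lub : forall U, (P <= U)%O -> (Q <= U)%O -> (T <= U)%O.
Hypothesis S_meet : forall x,
  x \in underlying P -> x \in underlying Q -> x \in underlying S.

(** Colour a point by f of its block in P, or else by g of its block in Q; where both apply they
    agree through S. Classes of equal colour form an upper bound U of P and Q, so T <= U and h reads
    off the colour of a block of T. [v0] is a mere default. *)
Lemma block_pushout (f : block P -> V) (g : block Q -> V) :
  (forall C, f (block_map SP C) = g (block_map SQ C)) ->
  exists h : block T -> V,
    (forall A, h (block_map PT A) = f A) /\ (forall B, h (block_map QT B) = g B).
Proof.
move=> fg.
pose c x := if [pick A : block P | x \in sval A] is Some A then f A else
  if [pick B : block Q | x \in sval B] is Some B then g B else v0.
have cP (A : block P) x : x \in sval A -> c x = f A.
  move=> xA; rewrite /c; case: pickP => [A' xA'|/(_ A)]; last by rewrite xA.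
  by rewrite (block_inj xA xA').
have cQ (B : block Q) x : x \in sval B -> c x = g B.
  move=> xB; have [/underlyingP[A xA]|xP] := boolP (x \in underlying P).
    have /underlyingP[C xC] : x \in underlying S.
      by apply: S_meet; apply/underlyingP; [exists A | exists B].
    rewrite (cP A) // (block_inj xA (block_map_mem SP xC)) fg.
    by rewrite (block_inj xB (block_map_mem SQ xC)).
  rewrite /c; case: pickP => [A xA|_].
    by case/negP: xP; apply/underlyingP; exists A.
  case: pickP => [B' xB'|/(_ B)]; last by rewrite xB.
  by rewrite (block_inj xB xB').
pose D := (underlying P :|: underlying Q)%SET.
have UP : finset.partition (finset.preim_partition c D)
    (finset.cover (finset.preim_partition c D)).
  have H := finset.preim_partitionP c D.
  by rewrite (finset.cover_partition H).
pose U := Subpart UP.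
have leU (P' : subpart X) (f' : block P' -> V) :
    (forall x, x \in underlying P' -> x \in D) ->
    (forall (A : block P') x, x \in sval A -> c x = f' A) -> (P' <= U)%O.
  move=> P'D cf'; apply/subpart_leP => A AP.
  have [x xA] := subpart_block_ex AP.
  have mD y : y \in A -> y \in D.
    by move=> yA; apply: P'D; apply/underlyingP; exists (exist _ A AP).
  exists [set y in D | c x == c y]%SET; first by apply/imsetP; exists x; rewrite // mD.
  apply/fintype.subsetP => y yA; rewrite inE mD //=.
  by rewrite !(cf' (exist _ A AP)).
have TU : (T <= U)%O.
  apply: T_lub; [apply: (leU _ f) => // x | apply: (leU _ g) => // x] => xP;
    by rewrite inE xP ?orbT.
have cT (C : block T) x y : x \in sval C -> y \in sval C -> c x = c y.
  move=> /(block_map_mem TU) + /(block_map_mem TU).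
  case: (block_map TU C) => /= W /imsetP[z _ ->].
  by rewrite !inE => /andP[_ /eqP <-] /andP[_ /eqP <-].
exists (fun C : block T => if [pick x in sval C] is Some x then c x else v0).
split=> A; have [x xA] := subpart_block_ex (svalP A).
  case: pickP => [y yA|/(_ x)]; last by rewrite /= block_map_mem.
  by rewrite -(cP _ _ xA); apply: cT yA (block_map_mem PT xA).
case: pickP => [y yA|/(_ x)]; last by rewrite /= block_map_mem.
by rewrite -(cQ _ _ xA); apply: cT yA (block_map_mem QT xA).
Qed.

End Pushout.

(** [block_pushout] on basis vectors with values in F, extended linearly. *)
Lemma free_block_pushout (F : fieldType) P Q S T
    (SP : (S <= P)%O) (SQ : (S <= Q)%O) (PT : (P <= T)%O) (QT : (Q <= T)%O)
    (f : {linear {ffun block P -> F^o} -> F^o})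
    (g : {linear {ffun block Q -> F^o} -> F^o}) :
  (forall U, (P <= U)%O -> (Q <= U)%O -> (T <= U)%O) ->
  (forall x, x \in underlying P -> x \in underlying Q -> x \in underlying S) ->
  (forall w, f (free_map (block_map SP) w) = g (free_map (block_map SQ) w)) ->
  exists h : {ffun block T -> F^o} -> F,
    (forall u, h (free_map (block_map PT) u) = f u) /\
    (forall u, h (free_map (block_map QT) u) = g u).
Proof.
move=> lub meet fg.
pose f' A : F := f (basisv F A); pose g' B : F := g (basisv F B).
have fg' (C : block S) : f' (block_map SP C) = g' (block_map SQ C).
  by have := fg (basisv F C); rewrite !free_map_basisv.
have [h [hf hg]] := block_pushout (0 : F) PT QT lub meet fg'.
exists (fun w => \sum_C w C * h C); split=> u; rewrite free_map_sum.
  rewrite [in RHS](ffun_expand u) linear_sum; apply: eq_bigr => A _.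
  by rewrite linearZ hf.
rewrite [in RHS](ffun_expand u) linear_sum; apply: eq_bigr => A _.
by rewrite linearZ hg.
Qed.

Lemma free_block_comp (F : fieldType) P Q S (PQ : (P <= Q)%O) (QS : (Q <= S)%O)
    (PS : (P <= S)%O) (v : {ffun block P -> F^o}) :
  free_map (block_map QS) (free_map (block_map PQ) v) = free_map (block_map PS) v.
Proof.
rewrite (ffun_expand v) !linear_sum; apply: eq_bigr => A _ /=.
by rewrite !linearZ /= !free_map_basisv -(block_map_comp _ _ PS).
Qed.

Lemma free_block_id (F : fieldType) P (PP : (P <= P)%O) (v : {ffun block P -> F^o}) :
  free_map (block_map PP) v = v.
Proof.
rewrite (ffun_expand v) !linear_sum; apply: eq_bigr => A _ /=.
by rewrite !linearZ /= !free_map_basisv block_map_id.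
Qed.

End SubpartPushout.

(** * The barcode of a formigram *)

Definition mkInt (R : realType) (s t : R) (st : s <= t) : Int R := @MkInt R (s, t) st.

(** A relation on reals, false unless s <= t, that hides the proof carried by members of [Int]. *)
Definition interval_ends (R : realType) (J : set (Int R)) (s t : R) : Prop :=
  exists st : s <= t, J (mkInt st).

Lemma interval_endsE (R : realType) (J : set (Int R)) s t (st : s <= t) :
  interval_ends J s t <-> J (mkInt st).
Proof.
split=> [[st']|]; last by exists st.
by have -> : mkInt st' = mkInt st by apply: val_inj.
Qed.

Lemma mkInt_ends (R : realType) (I : Int R) : exists st, I = @mkInt R (ends I).1 (ends I).2 st.
Proof. by exists (endsP I); apply: val_inj; rewrite /=; case: (ends I). Qed.

Lemma mkInt_le (R : realType) (s t s' t' : R) (st : s <= t) (st' : s' <= t') :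
  (mkInt st <= mkInt st')%O = (s' <= s) && (t <= t').
Proof. by []. Qed.

Lemma mem_mkInt (R : realType) (s t : R) (st : s <= t) x :
  Int_set (mkInt st) x <-> s <= x <= t.
Proof. by rewrite /Int_set /= in_itv. Qed.

(** At a point of C this is the tameness condition. Elsewhere local finiteness keeps C away from t,
    so theta is constant around t. *)
Lemma formigram_near (R : realType) (X : finType) (theta : formigram R X) (t : R) :
  exists2 r, 0 < r & forall s, t - r < s -> s < t + r -> (theta s <= theta t)%O.
Proof.
have [C [lf const crit]] := formigram_tame theta.
have [Ct|Ct] := pselect (C t).
  have [r r0 hr] := crit _ Ct; exists r => // s s1 s2.
  have [st|ts] := leP s t.
    have [+ _] := hr (t - s) ltac:(apply/andP; split; lra).
    by rewrite opprB addrC subrK.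
  have [_ +] := hr (s - t) ltac:(apply/andP; split; lra).
  by rewrite addrC subrK.
have [U nU finU] := lf t.
have clU : closed (U `&` C).
  have : @accessible_space R by apply: hausdorff_accessible; exact: norm_hausdorff.
  by move/accessible_finite_set_closed; apply.
have nV : nbhs t (~` (U `&` C)).
  apply: open_nbhs_nbhs; split; first by rewrite openC.
  by case.
have [r /= r0 rB] := (nbhs_ballP _ _).1 (filterI nU nV).
exists r => // s s1 s2; suff -> : theta s = theta t by [].
apply/esym/const.
apply: (@connected_component_max _ (~` C) `]t - r, t + r[%classic t).
- by rewrite /= in_itv /=; apply/andP; split; lra.
- move=> y /=; rewrite in_itv /= => /andP[y1 y2] Cy.
  have [Uy []] : (U `&` ~` (U `&` C)) y; last by split.
  by apply: rB; rewrite /ball /= distrC ltr_distl; apply/andP; split; lra.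
- exact/connected_intervalP/interval_is_interval.
- by rewrite /= in_itv /=; apply/andP; split; lra.
Qed.

(** * Members of the barcode satisfy the block axioms *)

Section BlockIntervals.
Variables (F : fieldType) (R : realType) (X : finType) (theta : formigram R X).

Let M := block_module F theta.

Lemma Int_join_ub (I : Int R) t : Int_set I t -> (theta t <= Int_join theta I)%O.
Proof. by move=> It; apply: subpart_join_ub; exists t. Qed.

Lemma underlying_Int_join (I : Int R) x : x \in underlying (Int_join theta I) ->
  exists2 t, Int_set I t & x \in underlying (theta t).
Proof. by case/underlying_join => _ [t It <-] xt; exists t. Qed.

(** Every time in [x,z] lies in [x,y] or [y,z], so the join over [x,z] is the least upper bound; a
    point alive on both sides of y is alive at y, its lifespan being an interval. *)
Lemma module_pushout (x y z : R) (xy : x <= y) (yz : y <= z) (xz : x <= z)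
    (I01 : (mkInt (lexx y) <= mkInt xy)%O) (I02 : (mkInt (lexx y) <= mkInt yz)%O)
    (I1 : (mkInt xy <= mkInt xz)%O) (I2 : (mkInt yz <= mkInt xz)%O)
    (f : {linear M (mkInt xy) -> F^o}) (g : {linear M (mkInt yz) -> F^o}) :
  (forall w, f (pmap M I01 w) = g (pmap M I02 w)) ->
  exists h : M (mkInt xz) -> F,
    (forall u, h (pmap M I1 u) = f u) /\ (forall u, h (pmap M I2 u) = g u).
Proof.
move=> fg; apply: (free_block_pushout (Int_join_le theta I1)
  (Int_join_le theta I2) _ _ fg).
  move=> U PU QU; apply: subpart_join_le => _ [t /mem_mkInt/andP[xt tz] <-].
  have [ty|yt] := leP t y.
    by apply: le_trans PU; apply: Int_join_ub; apply/mem_mkInt; rewrite xt.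
  by apply: le_trans QU; apply: Int_join_ub; apply/mem_mkInt; rewrite (ltW yt).
move=> p /underlying_Int_join[t1 /mem_mkInt/andP[_ t1y] p1].
move=> /underlying_Int_join[t2 /mem_mkInt/andP[yt2 _] p2].
have [L [_ iL _ LE]] := formigram_life theta p.
apply: (@underlying_le _ (theta y)).
  by apply: Int_join_ub; apply/mem_mkInt; rewrite lexx.
apply/LE; apply: (iL t1 t2); [exact/LE | exact/LE | by rewrite t1y].
Qed.

Variables (A : Type) (B : A -> poset_interval (Int R)).
Variables (c : coordinates M (fun a => pitv (B a))) (a : A).

Let J : set (Int R) := pitv (B a).
Let j := interval_ends J.
Let e I := unitv c I a.

(** If [y,y] is not in J, the coordinate on [x,y] and 0 on [y,z] agree on M([y,y]) and extend to a
    common h on M([x,z]). Then h is 1 on the image of the generator, which is 0 if [x,z] is not in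
    J. *)
Lemma ends_extendr x y z : y <= z -> j x y -> ~ j x z -> j y y.
Proof.
move=> yz [xy J1] nJ; apply: contrapT => nJ0; have xz := le_trans xy yz.
have I01 : (mkInt (lexx y) <= mkInt xy)%O by rewrite mkInt_le xy lexx.
have I02 : (mkInt (lexx y) <= mkInt yz)%O by rewrite mkInt_le yz lexx.
have I1 : (mkInt xy <= mkInt xz)%O by rewrite mkInt_le yz lexx.
have I2 : (mkInt yz <= mkInt xz)%O by rewrite mkInt_le xy lexx.
have J0 : ~ J (mkInt (lexx y)) by move=> ?; apply: nJ0; exists (lexx y).
have Jxz : ~ J (mkInt xz) by move=> ?; apply: nJ; exists xz.
have [w|h [h1 _]] := module_pushout (I01 := I01) (I02 := I02) I1 I2
    (f := coord c a) (g := \0).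
  by rewrite /= (coord_pmap c) // coord_out.
have h1' u : h (pmap M I1 u) = coord c a u := h1 u.
have := h1' (e (mkInt xy)); rewrite coord_unitv // /e unitv_pmap // unitv_out //.
by have := h1' 0; rewrite !linear0 => -> /eqP; rewrite eq_sym oner_eq0.
Qed.

Lemma ends_extendl x y z : x <= y -> j y z -> ~ j x z -> j y y.
Proof.
move=> xy [yz J2] nJ; apply: contrapT => nJ0; have xz := le_trans xy yz.
have I01 : (mkInt (lexx y) <= mkInt xy)%O by rewrite mkInt_le xy lexx.
have I02 : (mkInt (lexx y) <= mkInt yz)%O by rewrite mkInt_le yz lexx.
have I1 : (mkInt xy <= mkInt xz)%O by rewrite mkInt_le yz lexx.
have I2 : (mkInt yz <= mkInt xz)%O by rewrite mkInt_le xy lexx.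
have J0 : ~ J (mkInt (lexx y)) by move=> ?; apply: nJ0; exists (lexx y).
have Jxz : ~ J (mkInt xz) by move=> ?; apply: nJ; exists xz.
have [w|h [_ h2]] := module_pushout (I01 := I01) (I02 := I02) I1 I2
    (f := \0) (g := coord c a).
  by rewrite /= (coord_pmap c) // coord_out.
have h2' u : h (pmap M I2 u) = coord c a u := h2 u.
have := h2' (e (mkInt yz)); rewrite coord_unitv // /e unitv_pmap // unitv_out //.
by have := h2' 0; rewrite !linear0 => -> /eqP; rewrite eq_sym oner_eq0.
Qed.

(** The coordinates on both sides extend to M([x,z]), so the generator survives there. Without
    [y,y], the coordinate on the left and 0 on the right would extend too, giving the common image
    of both generators the values 1 and 0. *)
Lemma ends_glue x y z : j x y -> j y z -> j y y /\ j x z.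
Proof.
move=> [xy J1] [yz J2]; have xz := le_trans xy yz.
have I01 : (mkInt (lexx y) <= mkInt xy)%O by rewrite mkInt_le xy lexx.
have I02 : (mkInt (lexx y) <= mkInt yz)%O by rewrite mkInt_le yz lexx.
have I1 : (mkInt xy <= mkInt xz)%O by rewrite mkInt_le yz lexx.
have I2 : (mkInt yz <= mkInt xz)%O by rewrite mkInt_le xy lexx.
have jxz : j x z.
  apply: contrapT => nJ; have Jxz : ~ J (mkInt xz) by move=> ?; apply: nJ; exists xz.
  have [w|h [h1 _]] := module_pushout (I01 := I01) (I02 := I02) I1 I2
      (f := coord c a) (g := coord c a).
    by rewrite /= !(coord_pmap c).
  have h1' u : h (pmap M I1 u) = coord c a u := h1 u.
have := h1' (e (mkInt xy)); rewrite coord_unitv // /e unitv_pmap // unitv_out //.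
  by have := h1' 0; rewrite !linear0 => -> /eqP; rewrite eq_sym oner_eq0.
split=> //; apply: contrapT => nJ0.
have J0 : ~ J (mkInt (lexx y)) by move=> ?; apply: nJ0; exists (lexx y).
have [w|h [h1 h2]] := module_pushout (I01 := I01) (I02 := I02) I1 I2
    (f := coord c a) (g := \0).
  by rewrite /= (coord_pmap c) // coord_out.
have h1' u : h (pmap M I1 u) = coord c a u := h1 u.
have := h1' (e (mkInt xy)); rewrite coord_unitv // /e unitv_pmap //.
have h2' u : h (pmap M I2 u) = 0 := h2 u.
have := h2' (e (mkInt yz)); rewrite /e unitv_pmap // => ->.
by move/eqP; rewrite eq_sym oner_eq0.
Qed.

(** A block over [s,t] has an element alive at some x there, so its basis vector comes from
    M([x,x]). With no [x,x] in J the coordinate would vanish on all basis vectors. *)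
Lemma ends_gen s t : j s t -> exists x, [/\ s <= x, x <= t & j x x].
Proof.
move=> [st Jst]; apply: contrapT => nx.
have e1 : coord c a (e (mkInt st)) = 1 by rewrite coord_unitv.
suff : coord c a (e (mkInt st)) = 0 by rewrite e1 => /eqP; rewrite oner_eq0.
rewrite [e _]ffun_expand linear_sum big1 // => D _ /=; rewrite linearZ /=.
suff -> : coord c a (basisv F D : M (mkInt st)) = 0 by rewrite scaler0.
have [z zD] := subpart_block_ex (svalP D).
have /underlying_Int_join[x /mem_mkInt/andP[sx xt] zx] :
  z \in underlying (Int_join theta (mkInt st)) by apply/underlyingP; exists D.
have xI : (mkInt (lexx x) <= mkInt st)%O by rewrite mkInt_le sx xt.
have /underlyingP[C zC] : z \in underlying (Int_join theta (mkInt (lexx x))).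
  by apply: underlying_le zx; apply: Int_join_ub; apply/mem_mkInt; rewrite lexx.
have DE : basisv F D = pmap M xI (basisv F C).
  rewrite /= free_map_basisv; congr basisv; apply: block_inj zD _.
  exact: block_map_mem.
rewrite DE (coord_pmap c) // coord_out // => Jx.
by apply: nx; exists x; split=> //; exists (lexx x).
Qed.

(** On short intervals the join is attained at t, so the map from M([t,t]) is invertible and
    preserves the summands alive. *)
Lemma ends_near t : exists2 r, 0 < r & forall s s',
  t - r < s -> s <= t -> t <= s' -> s' < t + r -> (j s s' <-> j t t).
Proof.
have [r r0 near_t] := formigram_near theta t; exists r => // s s' rs st ts' s'r.
have ss' := le_trans st ts'.
have tI : (mkInt (lexx t) <= mkInt ss')%O by rewrite mkInt_le st ts'.
have QP : (Int_join theta (mkInt ss') <= Int_join theta (mkInt (lexx t)))%O.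
  apply: subpart_join_le => _ [u /mem_mkInt/andP[su us'] <-].
  apply: (@le_trans _ _ (theta t)); first by apply: near_t; lra.
  by apply: Int_join_ub; apply/mem_mkInt; rewrite lexx.
pose inv : M (mkInt ss') -> M (mkInt (lexx t)) := free_map (block_map QP).
have K v : inv (pmap M tI v) = v.
  by rewrite /inv /= (free_block_comp _ _ (lexx _)) free_block_id.
have K' v : pmap M tI (inv v) = v.
  by rewrite /inv /= (free_block_comp _ _ (lexx _)) free_block_id.
rewrite /j (interval_endsE _ ss') (interval_endsE _ (lexx t)).
split=> Js; apply: contrapT => Jt.
  have := coord_unitv c Js; rewrite -[unitv c _ a]K' (coord_pmap c) //.
  by rewrite coord_out // => /eqP; rewrite eq_sym oner_eq0.
have := coord_unitv c Js; rewrite -[unitv c _ a]K unitv_pmap // unitv_out //.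
by rewrite /inv linear0 linear0 => /eqP; rewrite eq_sym oner_eq0.
Qed.

Lemma ends_convex s t s' t' x y : j s t -> j s' t' ->
  s' <= x -> x <= s -> t <= y -> y <= t' -> j x y.
Proof.
move=> [st J1] [st' J2] s'x xs ty yt'.
have xy : x <= y by lra.
by exists xy; apply: (pitv_convex J1 J2); rewrite mkInt_le; apply/andP.
Qed.

(* If y is not in the diagonal of J, every I in J generates from exactly one side
   of y; comparable elements of J lie on the same side, so connectedness of J
   puts all of J on one side. *)
Lemma ends_diag x y z : j x x -> j z z -> x <= y -> y <= z -> j y y.
Proof.
move=> [xx Jx] [zz Jz] xy yz; apply: contrapT => ny.
have xy' : x < y.
  by rewrite lt_neqAle xy andbT; apply/eqP => xyE; apply: ny; rewrite -xyE; exists xx.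
have yz' : y < z.
  by rewrite lt_neqAle yz andbT; apply/eqP => yzE; apply: ny; rewrite yzE; exists zz.
pose left (I : Int R) := (ends I).2 < y \/
  ((ends I).1 <= y /\ y <= (ends I).2 /\ j (ends I).1 y).
suff : left (mkInt zz) by case=> /=; lra.
apply: (@poset_interval_ind _ _ (B a) left (mkInt xx) (mkInt zz) Jx Jz).
  by left.
move=> I I'; have [pq ->] := mkInt_ends I; have [pq' ->] := mkInt_ends I'.
move: (ends I).1 (ends I).2 (ends I').1 (ends I').2 pq pq' => p q p' q' pq pq'.
move=> JI JI'; have jpq : j p q by exists pq.
have jpq' : j p' q' by exists pq'.
rewrite /left /= => /orP[]; rewrite mkInt_le => /andP[le1 le2] L.
  have [q'y|yq'] := ltP q' y; [by left | right].
  have p'y : p' <= y by case: L => [|[? _]]; lra.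
  do !split=> //; case: L => [qy|[py [yq jpy]]].
    by apply: (ends_convex jpq jpq') => //; lra.
  by apply: (ends_convex jpy jpq') => //; lra.
have [q'y|yq'] := ltP q' y; [by left | right].
case: L => [|[py [yq jpy]]]; first lra.
have noyq : ~ j y q by move=> jyq; apply: ny; case: (ends_glue jpy jyq).
have p'y : p' <= y.
  rewrite leNgt; apply/negP => yp'; apply: noyq.
  by apply: (ends_convex jpq' jpq); lra.
(* u <= y gives [p',y], while u > y would give [y,q'] and hence [y,q]. *)
do !split=> //; have [u [p'u uq' ju]] := ends_gen jpq'.
have [uy|yu] := leP u y; first by apply: (ends_convex ju jpq'); lra.
case: noyq; have jyq' : j y q' by apply: (ends_convex ju jpq'); lra.
by apply: (ends_convex jyq' jpq); lra.
Qed.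

Lemma ends_axioms : block_axioms j.
Proof.
split.
- exact: ends_convex.
- exact: ends_gen.
- exact: ends_glue.
- exact: ends_extendl.
- exact: ends_extendr.
- exact: ends_near.
- exact: ends_diag.
Qed.

Lemma ends_inhabited : exists x, j x x.
Proof.
have [I] := pitv_nonempty (B a); have [st ->] := mkInt_ends I => JI.
by have [|x [_ _ jx]] := @ends_gen (ends I).1 (ends I).2; [exists st | exists x].
Qed.

End BlockIntervals.

(** A member alive at I has a nonzero coordinate on one of the finitely many basis vectors, and each
    of these has finitely many nonzero coordinates. *)
Lemma coord_members_finite (F : fieldType) (R : realType) (X : finType)
    (theta : R -> subpart X) (A : Type) (B : A -> set (Int R))
    (c : coordinates (block_module F theta) B) (I : Int R) :
  finite_set [set b | B b I].
Proof.
pose D := block (Int_join theta I).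
apply: (@sub_finite_set _ _ (\bigcup_(x in [set: D])
    [set b | coord c b (basisv F x : block_module F theta I) <> 0])).
  move=> b /= Jb; apply: contrapT => nb.
  have := coord_unitv c Jb; rewrite [unitv c I b]ffun_expand linear_sum big1.
    by move/eqP; rewrite eq_sym oner_eq0.
  move=> x _; rewrite linearZ /= [coord c b _](_ : _ = 0) ?scaler0 //.
  by apply: contrapT => nx; apply: nb; exists x.
apply: bigcup_finite => [|x _]; last exact: coord_fin.
exact: finite_finset.
Qed.

(** * Smoothing *)

Lemma smoothing_match_eq (R : realType) (eps : R) (K K' L L' : set R) :
  smoothing_match eps L L' -> K = L -> K' = L' -> smoothing_match eps K K'.
Proof. by move=> m -> ->. Qed.

Local Ltac eq_itv := apply/predeqP => t;
  rewrite /= ?in_itv /= ?lee_fin ?lte_fin ?ltNyr ?ltry ?andbT;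
  by [| split; lra].

(** On [t - eps, t + eps] the condition at an open end moves it inwards by eps, at a closed end
    outwards. With two finite open ends, non-removal gives b + eps < d - eps. *)
Lemma smoothing_match_bounds (R : realType) (eps : R) (lo hi : itv_bound R) :
  0 <= eps -> [set` Interval lo hi] !=set0 ->
  ~ smoothing_removed eps [set` Interval lo hi] ->
  (exists t, lower_cond lo (t - eps) (t + eps) &&
    upper_cond hi (t - eps) (t + eps)) /\
  smoothing_match eps [set` Interval lo hi] [set t |
    lower_cond lo (t - eps) (t + eps) && upper_cond hi (t - eps) (t + eps)].
Proof.
move=> e0 [x]; case: lo => [[] b|[]]; case: hi => [[] d|[]];
  rewrite /= in_itv //= ?andbT ?andbF // => xK nrem.
- have bd : b < d by lra.
  split; first by exists (b - eps); lra.
  have m : (b%:E < d%:E)%E by rewrite lte_fin.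
  by apply: (smoothing_match_eq (match_co eps m)); eq_itv.
- have bd : b <= d by lra.
  split; first by exists b; lra.
  by apply: (smoothing_match_eq (match_cc eps bd)); eq_itv.
- split; first by exists b; lra.
  by apply: (smoothing_match_eq (match_co eps (ltry b))); eq_itv.
- have bd : b + eps < d - eps.
    rewrite ltNge; apply/negP => db; apply: nrem; exists b, d.
    by split=> //; lra.
  split; first by exists ((b + d) / 2); lra.
  have m : (b%:E + eps%:E < d%:E - eps%:E)%E by rewrite -EFinD -EFinB lte_fin.
  by apply: (smoothing_match_eq (match_oo m)); eq_itv.
- have bd : b < d by lra.
  split; first by exists (d + eps); lra.
  have m : (b%:E < d%:E)%E by rewrite lte_fin.
  by apply: (smoothing_match_eq (match_oc eps m)); eq_itv.
- split; first by exists (b + eps + 1); lra.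
  have m : (b%:E + eps%:E < +oo - eps%:E)%E by rewrite -EFinD ltry.
  by apply: (smoothing_match_eq (match_oo m)); eq_itv.
- split; first by exists (d - eps - 1); lra.
  have m : (-oo + eps%:E < d%:E - eps%:E)%E by rewrite -EFinB ltNyr.
  by apply: (smoothing_match_eq (match_oo m)); eq_itv.
- split; first by exists d; lra.
  by apply: (smoothing_match_eq (match_oc eps (ltNyr d))); eq_itv.
- split; first by exists 0.
  have m : (-oo + eps%:E < +oo - eps%:E)%E by [].
  by apply: (smoothing_match_eq (match_oo m)); eq_itv.
Qed.

(** With its upper counterpart, it lets two members be joined through their hull. *)
Lemma lower_cond_hull (R : realType) (e : R) lo s t s' t' :
  lower_cond lo (s - e) (t + e) -> lower_cond lo (s' - e) (t' + e) ->
  lower_cond lo (Num.min s s' - e) (Num.max t t' + e).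
Proof.
case: lo => [[] b|c] //=; first by rewrite -!lerBlDr le_max => ->.
by rewrite !ltrBrDr lt_min => -> ->.
Qed.

Lemma upper_cond_hull (R : realType) (e : R) hi s t s' t' :
  upper_cond hi (s - e) (t + e) -> upper_cond hi (s' - e) (t' + e) ->
  upper_cond hi (Num.min s s' - e) (Num.max t t' + e).
Proof.
case: hi => [[] d|c] //=; first by rewrite -!ltrBrDr gt_max => -> ->.
by rewrite !lerBlDr ge_min => ->.
Qed.

(** * The module of the smoothing *)

Section Smoothing.
Variables (F : fieldType) (R : realType) (X : finType) (theta : formigram R X).
Variables (eps : R) (eps0 : 0 <= eps).

Fact thicken_subproof (I : Int R) : (ends I).1 - eps <= (ends I).2 + eps.
Proof. by move: (endsP I) eps0 => ? ?; lra. Qed.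

Definition thicken (I : Int R) : Int R := mkInt (thicken_subproof I).

Lemma thicken_le I I' : (I <= I')%O -> (thicken I <= thicken I')%O.
Proof. by case/andP => h1 h2; rewrite mkInt_le; apply/andP; split; lra. Qed.

Let M := block_module F theta.
Let M' := block_module F (smoothing eps theta).

Lemma Int_join_smoothing I :
  Int_join (smoothing eps theta) I = Int_join theta (thicken I).
Proof. exact: join_over_smoothing. Qed.

Fact to_thicken_le I :
  (Int_join (smoothing eps theta) I <= Int_join theta (thicken I))%O.
Proof. by rewrite Int_join_smoothing. Qed.

Fact of_thicken_le I :
  (Int_join theta (thicken I) <= Int_join (smoothing eps theta) I)%O.
Proof. by rewrite Int_join_smoothing. Qed.

(** The two subpartitions are equal; block maps in both directions replace a cast between dependent
    types. *)
Definition to_thicken I : {linear M' I -> M (thicken I)} :=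
  @free_map F _ _ (block_map (to_thicken_le I)).

Definition of_thicken I : {linear M (thicken I) -> M' I} :=
  @free_map F _ _ (block_map (of_thicken_le I)).

Lemma to_thickenK I : cancel (to_thicken I) (of_thicken I).
Proof.
move=> v; rewrite /to_thicken /of_thicken /=.
by rewrite (free_block_comp _ _ (lexx _)) free_block_id.
Qed.

Lemma of_thickenK I : cancel (of_thicken I) (to_thicken I).
Proof.
move=> v; rewrite /to_thicken /of_thicken /=.
by rewrite (free_block_comp _ _ (lexx _)) free_block_id.
Qed.

Lemma to_thicken_pmap I I' (le : (I <= I')%O) v :
  to_thicken I' (pmap M' le v) = pmap M (thicken_le le) (to_thicken I v).
Proof.
have PS : (Int_join (smoothing eps theta) I <= Int_join theta (thicken I'))%O.
  exact: le_trans (Int_join_le _ le) (to_thicken_le I').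
by rewrite /to_thicken /= !(free_block_comp _ _ PS).
Qed.

Variables (A : Type) (B : A -> set (Int R)) (D : A -> Prop).
Variable c : coordinates M B.
Hypothesis B_D : forall I a, B a (thicken I) -> D a.

Lemma coordinates_smoothing :
  coordinates M' (fun (a : {a | D a}) I => B (sval a) (thicken I)).
Proof.
apply: (@Coordinates F _ _ M' _ _
  (fun I a v => coord c (sval a) (to_thicken I v))
  (fun I a => of_thicken I (unitv c (thicken I) (sval a)))).
- by move=> I a k u v; rewrite !linearP.
- by move=> I a v Ba; rewrite coord_out.
- by move=> I a Ba; rewrite unitv_out // linear0.
- move=> I a Ba; rewrite (@of_thickenK I).
  exact: (coord_unitv c Ba).
- move=> I [a Da] [b Db] ab; rewrite (@of_thickenK I); apply: coord_unitv_neq => /= abE.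
  by apply: ab; subst b; congr exist; apply: Prop_irrelevance.
- by move=> I I' le a v Ba; rewrite to_thicken_pmap coord_pmap.
- move=> I I' le a Ba; apply: (can_inj (@to_thickenK I')).
  rewrite to_thicken_pmap (@of_thickenK I) (@of_thickenK I').
  exact: (unitv_pmap c _ Ba).
- move=> I v v0; apply: (can_inj (@to_thickenK I)); rewrite linear0.
  apply: (@coord_eq0 _ _ _ _ _ _ c) => a.
  have [Ba|Ba] := pselect (B a (thicken I)); last by rewrite coord_out.
  exact: (v0 (exist _ a (B_D Ba))).
- move=> I v; apply: (@finite_preimage _ _ [set a | coord c a (to_thicken I v) <> 0]
    sval _ (coord_fin c _)).
  move=> [a Da] [b Db] _ _ /= abE.
  by subst b; congr exist; apply: Prop_irrelevance.
Qed.

End Smoothing.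

Theorem propositionC2 (F : fieldType) (R : realType) (X : finType)
  (theta : formigram R X) (eps : R) (A A' : Type)
  (B : A -> poset_interval (Int R)) (B' : A' -> poset_interval (Int R)) :
  (0 < #|X|)%N -> 0 <= eps ->
  is_barcode (block_module F theta) B ->
  is_barcode (block_module F (smoothing eps theta)) B' ->
  exists f : {a : A | ~ smoothing_removed eps (zz_barcode B a)} -> A',
    bijective f /\
    forall a, smoothing_match eps (zz_barcode B (sval a)) (zz_barcode B' (f a)).
Proof.
move=> _ e0 /barcode_coordinates[c] /barcode_coordinates[c'].
pose j a := interval_ends (pitv (B a)).
have ax a : block_axioms (j a) := ends_axioms c a.
have Bj a s t (st : s <= t) : pitv (B a) (mkInt st) <-> j a s t.
  by rewrite -interval_endsE.
have zzE a : zz_barcode B a = [set t | j a t t].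
  by apply/predeqP => t; rewrite /= -(Bj a t t (lexx t)).
pose D a := ~ smoothing_removed eps (zz_barcode B a).
(* For a removed member the thickening would lie strictly inside ]b, d[, yet its length is at least
   2 eps. *)
have BD I a : pitv (B a) (thicken e0 I) -> D a.
  move/Bj => jI [b [d [/andP[bd dbe]]]]; rewrite zzE => KE.
  have K t : j a t t <-> b < t < d.
    by have -> : j a t t = [set t | j a t t] t by []; rewrite KE /= in_itv.
  have bI : b < (ends I).1 - eps.
    apply: (@block_open_left _ _ (ax a) b ((b + d) / 2)) jI.
    - by move/K; rewrite ltxx.
    - by lra.
    - by move=> x ? ?; apply/K; lra.
    - by move=> x /K; lra.
  have Id : (ends I).2 + eps < d.
    rewrite -ltrN2; apply: (@block_open_left _ _ (mirror_axioms (ax a))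
      (- d) (- ((b + d) / 2)) _ (- ((ends I).1 - eps))).
    - by rewrite /mirror opprK => /K; rewrite ltxx andbF.
    - by lra.
    - by move=> x ? ?; apply/K; lra.
    - by rewrite /mirror => x /K; lra.
    - by rewrite /mirror !opprK.
  by move: (endsP I) => ?; lra.
have shape (a : {a | D a}) : exists lo hi : itv_bound R,
    [/\ zz_barcode B (sval a) = [set` Interval lo hi],
    (forall I, pitv (B (sval a)) (thicken e0 I) <->
      lower_cond lo ((ends I).1 - eps) ((ends I).2 + eps) &&
      upper_cond hi ((ends I).1 - eps) ((ends I).2 + eps)) &
    [set` Interval lo hi] !=set0].
  have [lo [hi [K jE]]] := block_shape (ax (sval a)) (ends_inhabited c (sval a)).
  have [x jx] := ends_inhabited c (sval a).
  exists lo, hi; split; last by exists x; apply/K.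
    by rewrite zzE; apply/predeqP => t; rewrite /= K.
  by move=> I; rewrite Bj; apply: jE; apply: thicken_subproof.
pose J (a : {a | D a}) := [set I | pitv (B (sval a)) (thicken e0 I)].
have J0 a : J a !=set0.
  have [lo [hi [KE JE K0]]] := shape a; have := svalP a; rewrite /D KE => nrem.
  have [[t tJ] _] := smoothing_match_bounds e0 K0 nrem.
  by exists (point_Int t); apply/JE.
have Jconv a I1 I2 I3 : J a I1 -> J a I3 -> (I1 <= I2)%O -> (I2 <= I3)%O -> J a I2.
  move=> J1 J3 le12 le23.
  by apply: (pitv_convex J1 J3); apply: thicken_le.
have Jconn a I1 I2 : J a I1 -> J a I2 -> exists s : seq (Int R),
    [/\ forall I, I \in s -> J a I, path (>=<%O) I1 s & last I1 s = I2].
  move=> J1 J2; have [lo [hi [_ JE _]]] := shape a.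
  have hull : Num.min (ends I1).1 (ends I2).1 <= Num.max (ends I1).2 (ends I2).2.
    by rewrite ge_min le_max endsP.
  exists [:: mkInt hull; I2]; split=> //=.
    move=> I; rewrite !inE => /orP[] /eqP -> //; apply/JE => /=.
    move: J1 J2 => /JE/andP[L1 U1] /JE/andP[L2 U2].
    by rewrite lower_cond_hull // upper_cond_hull.
  have leE (I I' : Int R) :
    (I <= I')%O = ((ends I').1 <= (ends I).1) && ((ends I).2 <= (ends I').2) by [].
  by rewrite /Order.comparable !leE /= !ge_min !le_max !lexx ?orbT.
pose Be a := PosetInterval (J0 a) (Jconv a) (Jconn a).
have ce : coordinates _ (fun a => pitv (Be a)) := coordinates_smoothing c BD.
(* [ce] and [c'] decompose the same module, that of the smoothing. *)
have [f fbij fE] := coordinates_bijection ce c'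
  (coord_members_finite ce) (coord_members_finite c').
exists f; split=> // a; have [lo [hi [KE JE K0]]] := shape a.
have := svalP a; rewrite /D KE => nrem.
have [_ m] := smoothing_match_bounds e0 K0 nrem.
apply: (smoothing_match_eq m) => //.
by rewrite /zz_barcode fE; apply/predeqP => t; apply: JE.
Qed.
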